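(* Let $d\ge1$ be an integer, let $G$ be either $\mathbb{Z}^d$ or $\mathbb{N}_0^d$, let $F$ be a finite set with at least $2$ elements, and let $\Sigma=F^G$. There is a continuous family of Lipschitz continuous potentials $\left(\varphi(\underline{\varsigma})\right)_{\underline{\varsigma}\in\{+,-\}^{\mathbb{N}}}$ on $\Sigma$ (i.e. $\underline{\varsigma}\mapsto\varphi(\underline{\varsigma})$ is continuous from $\{+,-\}^{\mathbb{N}}$ to the space of Lipschitz functions with the norm $\|\cdot\|_{\mathrm{Lip}}$), complementary open subsets $U^+$ and $U^-$ of $\Sigma$, and an increasing sequence of positive numbers $(\beta_m)_{m\in\mathbb{N}}$ converging to $+\infty$, such that the following property holds: for every $\underline{\varsigma}=(\varsigma(m))_{m\in\mathbb{N}}$ in $\{+,-\}^{\mathbb{N}}$, every pair of integers $m$ and $\widehat{m}$ such that $$\widehat{m}\ge m\ge1\quad\text{and}\quad\varsigma(m)=\cdots=\varsigma(\widehat{m}),$$ every $\beta$ in $[\beta_m,\beta_{\widehat{m}}]$, and every translation invariant Gibbs measure $\rho$ for the potential $\beta\cdot\varphi(\underline{\varsigma})$, we have $$\rho(U^{\varsigma(m)})\ge1-2^{-m}.$$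
   Context: $\mathbb{N}=\{1,2,\dots\}$, $\mathbb{N}_0=\{0,1,2,\dots\}$. $\{+,-\}$ has the discrete topology and $\{+,-\}^{\mathbb{N}}$ the product topology. $\Sigma=F^G$ is endowed with the distance $\mathrm{dist}((\theta_n)_{n\in G},(\theta'_n)_{n\in G})=2^{-\min\{\|n\|:\theta_n\ne\theta'_n\}}$ for distinct elements, where $\|\cdot\|$ is the sup-norm. $\sigma$ denotes the action of $G$ on $\Sigma$ by translations; $\mathcal{M}_\sigma$ is the space of $\sigma$-invariant Borel probability measures on $\Sigma$; $h_\nu$ is the measure-theoretic entropy of $\nu\in\mathcal{M}_\sigma$. For continuous $\varphi\colon\Sigma\to\mathbb{R}$, the pressure is $P(\varphi)=\sup\{h_\nu+\int\varphi\,d\nu:\nu\in\mathcal{M}_\sigma\}$. An equilibrium state for $\varphi$ is a measure $\nu\in\mathcal{M}_\sigma$ attaining this supremum; ''translation invariant Gibbs measure for the potential $\varphi$'' means equilibrium state for $\varphi$. $\|\varphi\|_{\mathrm{Lip}}=\sup_{x}|\varphi(x)|+\sup_{x\ne x'}\frac{|\varphi(x)-\varphi(x')|}{\mathrm{dist}(x,x')}$, and $\varphi$ is Lipschitz continuous if $\|\varphi\|_{\mathrm{Lip}}<+\infty$. Two subsets of $\Sigma$ are complementary if each is the complement of the other. *)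

(* Defs.v *)
From HB Require Import structures.
From mathcomp Require Import all_boot all_order all_algebra finmap.
From mathcomp Require Import all_classical all_reals all_analysis.

Set Implicit Arguments.
Unset Strict Implicit.
Unset Printing Implicit Defensive.

Import Order.TTheory GRing.Theory Num.Theory.
Import numFieldNormedType.Exports.

Local Open Scope classical_set_scope.
Local Open Scope ring_scope.

Variant coordinates := CoordZ | CoordN.

Definition coord_type (c : coordinates) : nmodType :=
  match c with CoordZ => int | CoordN => nat end.

Definition coord_abs (c : coordinates) : coord_type c -> nat :=
  match c with CoordZ => absz | CoordN => id end.

(* [lattice CoordZ d] is Z^d and [lattice CoordN d] is N_0^d. *)
Definition lattice (c : coordinates) (d : nat) : nmodType :=
  {ffun 'I_d -> coord_type c}.

Definition supnorm (c : coordinates) (d : nat) (g : lattice c d) : nat :=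
  (\max_(i < d) coord_abs ((g : {ffun 'I_d -> coord_type c}) i))%N.

(* The space F^G. The parameter [R] is where the distance takes its values;
   [hF] provides the point that measurable types must carry. *)
Definition config (R : realType) (c : coordinates) (d : nat) (F : finType)
  (hF : (1 < #|F|)%N) : Type := lattice c d -> F.

Section Metric.
Context (R : realType) (c : coordinates) (d : nat) (F : finType).
Context (hF : (1 < #|F|)%N).
Local Notation G := (lattice c d).
Local Notation Sigma := (config R c d hF).
Implicit Types x y z : Sigma.

Lemma letter_exists : exists a : F, a \in F.
Proof. exact/card_gt0P/ltnW. Qed.

Definition config_point : Sigma := fun=> xchoose letter_exists.

Lemma neq_config x y : x <> y ->
  exists n, `[< exists2 g : G, x g <> y g & supnorm g = n >].
Proof.
move=> xy; have [g xyg] : exists g : G, x g <> y g.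
  by apply: contrapT => h; apply: xy; apply/funext => g; apply: contrapT => ?;
     apply: h; exists g.
by exists (supnorm g); apply/asboolP; exists g.
Qed.

Definition dist x y : R :=
  match pselect (x = y) with
  | left _ => 0
  | right xy => 2 ^- ex_minn (neq_config xy)
  end.

Lemma dist_xx x : dist x x = 0.
Proof. by rewrite /dist; case: pselect. Qed.

Lemma dist_eq0 x y : dist x y = 0 -> x = y.
Proof.
rewrite /dist; case: pselect => // xy /eqP.
by rewrite invr_eq0 expf_eq0 pnatr_eq0 andbF.
Qed.

Lemma dist_le x y n :
  dist x y <= 2 ^- n <-> forall g : G, (supnorm g < n)%N -> x g = y g.
Proof.
rewrite /dist; case: pselect => [->|xy].
  by split => // _; rewrite invr_ge0 exprn_ge0.
case: ex_minnP => m /asboolP[g xyg gm] mmin.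
rewrite lef_pV2 ?posrE ?exprn_gt0// ler_eXn2l ?ltr1n//; split => [nm h hn|h].
  apply: contrapT => xyh; suff : (m <= supnorm h)%N.
    by rewrite leqNgt (leq_trans hn nm).
  by apply: mmin; apply/asboolP; exists h.
by rewrite leqNgt; apply/negP => mn; apply: xyg; apply: h; rewrite gm.
Qed.

Lemma dist_sym x y : dist x y = dist y x.
Proof.
have le_sym u v : dist u v <= dist v u.
  rewrite {2}/dist; case: pselect => [->|vu]; first by rewrite dist_xx.
  apply/dist_le => g gm; apply/esym; move: g gm; apply/dist_le.
  by rewrite /dist; case: pselect => // vu'; rewrite (Prop_irrelevance vu vu').
by apply/eqP; rewrite eq_le !le_sym.
Qed.

Lemma dist_ge0 x y : 0 <= dist x y.
Proof. by rewrite /dist; case: pselect => // ?; rewrite invr_ge0 exprn_ge0. Qed.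

Lemma dist_triangle y x z : dist x z <= dist x y + dist y z.
Proof.
have dE u v : u = v \/ exists n, dist u v = 2 ^- n.
  rewrite /dist; case: pselect => [|uv]; first by left.
  by right; eexists.
have [->|[m mE]] := dE x y; first by rewrite dist_xx add0r.
have [<-|[n nE]] := dE y z; first by rewrite dist_xx addr0.
have xym := (dist_le x y m).1; rewrite mE lexx in xym.
have yzn := (dist_le y z n).1; rewrite nE lexx in yzn.
have xz : dist x z <= 2 ^- minn m n.
  apply/dist_le => g; rewrite leq_min => /andP[gm gn].
  by rewrite xym// yzn.
apply: (le_trans xz); rewrite mE nE.
by case: leqP => _; rewrite ?lerDl ?lerDr invr_ge0 exprn_ge0.
Qed.

HB.instance Definition _ := gen_eqMixin Sigma.
HB.instance Definition _ := gen_choiceMixin Sigma.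
HB.instance Definition _ := isPointed.Build Sigma config_point.
HB.instance Definition _ :=
  isMetric.Build R Sigma dist_xx dist_eq0 dist_sym dist_triangle.

End Metric.

Section Thermodynamics.
Context (R : realType) (c : coordinates) (d : nat) (F : finType).
Context (hF : (1 < #|F|)%N).
Local Notation G := (lattice c d).
Local Notation Sigma := (config R c d hF).

Definition borel := g_sigma_algebraType (@open Sigma).

Definition shift (g : G) (x : Sigma) : Sigma := fun h => x (g + h).

Definition shift_invariant (nu : probability borel R) : Prop :=
  forall (g : G) (A : set borel), measurable A -> nu (shift g @^-1` A) = nu A.

Definition finite_measurable_partition (P : set (set borel)) : Prop :=
  [/\ finite_set P, partition P id [set: borel] & P `<=` measurable].

(* {g : ||g|| < n}, that is {0, ..., n-1}^d or {-(n-1), ..., n-1}^d. *)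
Definition box (n : nat) : set G := [set g | (supnorm g < n)%N].

(* The common refinement of the partitions shift_g^{-1} P, for g in L;
   it may contain the empty set, which does not contribute to the entropy. *)
Definition join_shifts (L : set G) (P : set (set borel)) : set (set borel) :=
  [set B | exists A : G -> set borel, (forall g, P (A g)) /\
     B = \bigcap_(g in L) (shift g @^-1` A g)].

(* A zero mass contributes 0, because [ln 0 = 0]. *)
Definition partition_entropy (nu : probability borel R)
    (P : set (set borel)) : R :=
  - \sum_(A \in P) fine (nu A) * ln (fine (nu A)).

Definition entropy_wrt (nu : probability borel R) (P : set (set borel)) : R :=
  limn (fun n => partition_entropy nu (join_shifts (box n) P)
                 / (#|` fset_set (box n)|%N)%:R).

Definition entropy (nu : probability borel R) : \bar R :=
  ereal_sup [set (entropy_wrt nu P)%:E | P in finite_measurable_partition].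

Definition free_energy (phi : Sigma -> R) (nu : probability borel R) : \bar R :=
  (entropy nu + \int[nu]_x (phi x)%:E)%E.

Definition pressure (phi : Sigma -> R) : \bar R :=
  ereal_sup [set free_energy phi nu | nu in shift_invariant].

Definition equilibrium_state (phi : Sigma -> R) (nu : probability borel R) :
  Prop := shift_invariant nu /\ free_energy phi nu = pressure phi.

Definition lip_norm (phi : Sigma -> R) : \bar R :=
  (ereal_sup [set `|phi x|%:E | x in [set: Sigma]] +
   ereal_sup [set (`|phi p.1 - phi p.2| / mdist p.1 p.2)%:E
             | p in [set p : Sigma * Sigma | p.1 <> p.2]])%E.

Definition lipschitz_continuous (phi : Sigma -> R) : Prop :=
  (lip_norm phi < +oo)%E.

Definition continuous_in_lip_norm (T : topologicalType)
    (phi : T -> Sigma -> R) : Prop :=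
  forall (s : T) (e : R), 0 < e ->
    \forall t \near s, (lip_norm (fun x => (phi t x - phi s x)%R) < e%:E)%E.

End Thermodynamics.

(* The space {+,-}^N: [true] stands for + and [false] for -, and the sequence
   varsigma(1), varsigma(2), ... is indexed from 0, so that [s m] is
   varsigma(m+1). The sequence of inverse temperatures is likewise indexed
   from 0, and the bound at index m is 1 - 2^-(m+1). *)
Notation sign_sequences := cantor_space.

(* Main.v *)
From HB Require Import structures.
From mathcomp Require Import all_boot all_order all_algebra finmap.
From mathcomp Require Import all_classical all_reals all_analysis.
From mathcomp Require Import measurable_realfun ring lra zify.
Require Import Defs.
Import Order.TTheory GRing.Theory Num.Theory.
Import numFieldNormedType.Exports.
Local Open Scope classical_set_scope.
Local Open Scope ring_scope.

Set Implicit Arguments.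
Unset Strict Implicit.
Unset Printing Implicit Defensive.

(** For a letter [a] and a period [p], consider the configurations that equal
    [a] off the hyperplanes [g_1 = q mod p], for some [q]; their entropy is
    [ln #|F| / p].  The potential penalizes, at each scale [k], the
    configurations whose pattern on a segment of length [width k] does not occur
    among these for [a = +] with period [p_k^+] or for [a = -] with period
    [p_k^-].  The period of a side grows each time the sign is opposite to it,
    so that at scale [m] the side of sign [s m] has the smaller period, hence
    the larger entropy.  The penalty [cost k] decreases so fast that at
    [beta m = 2 ln #|F| / cost m] the constraints up to scale [m] are enforced
    while the later ones are negligible.  The pressure is at least the entropy
    of the favoured side, witnessed by independent uniform letters on the
    hyperplanes; on the other hand the entropy of an equilibrium state is at
    most that of its patterns on the segment of length [width m], which would be
    smaller if it gave mass to the other side. *)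

(** * Shannon entropy of finite distributions *)

(** What scale [k] charges depends only on the signs up to [k], which makes the family continuous; a
    side therefore cannot be excluded once and for all, since a later sign may favour it, and it is
    only made poorer. Periods are powers of 3, so they are totally ordered by divisibility and a
    longer period satisfies every constraint with a shorter one. Hence the measure on the favoured
    side pays nothing at any scale up to [mhat], including the scales before [m].

    The constants settle one race. At scale [m] the free hyperplanes of the favoured side have
    density [u >= 3 ^- (m + 1)], those of the other side [v = 3 ^- (m + 2)], so mass outside the
    favoured patterns loses entropy in proportion to [v]. Two errors oppose this: the logarithms of
    counting prefactors divided by [width m], and the penalties beyond [mhat]. In units of
    [ln #|F|], each is kept below [8 ^- (m + 2)], which leaves at most
    [(3 / 8) ^ (m + 2) <= 2 ^- (m + 1)] for the mass outside. *)

Section FiniteEntropy.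
Context (R : realType).

Definition ent (A : finType) (p : A -> R) : R := - \sum_a p a * ln (p a).

Definition image_pmf (A B : finType) (h : A -> B) (p : A -> R) (b : B) : R :=
  \sum_(a | h a == b) p a.

Definition is_pmf (A : finType) (p : A -> R) : Prop :=
  (forall a, 0 <= p a) /\ \sum_a p a = 1.

Lemma pmf_le1 (A : finType) (p : A -> R) a : is_pmf p -> p a <= 1.
Proof.
by move=> [p0 <-]; rewrite (bigD1 a)//= lerDl sumr_ge0.
Qed.

Lemma ln_le_subr1 (x : R) : 0 < x -> ln x <= x - 1.
Proof.
move=> x0; have h : -1 < x - 1 by lra.
by have := le_ln1Dx h; rewrite (_ : 1 + (x - 1) = x)//; ring.
Qed.

Lemma gibbs (A : finType) (p q : A -> R) : is_pmf p -> (forall a, 0 <= q a) ->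
  (forall a, 0 < p a -> 0 < q a) -> \sum_a q a <= 1 ->
  ent p <= - \sum_a p a * ln (q a).
Proof.
move=> [p0 p1] q0 pq q1; rewrite /ent -subr_ge0 opprK addrC -sumrB.
have: 0 <= \sum_a (p a - q a) by rewrite sumrB p1 subr_ge0.
move=> /le_trans; apply; apply: ler_sum => a _.
have [->|pa] := eqVneq (p a) 0; first by rewrite !mul0r subrr sub0r oppr_le0.
have pa0 : 0 < p a by rewrite lt_neqAle eq_sym pa p0.
have qa0 := pq _ pa0.
have := ln_le_subr1 (divr_gt0 qa0 pa0).
rewrite ln_div ?posrE// => h.
have : p a * (ln (q a) - ln (p a)) <= p a * (q a / p a - 1) by rewrite ler_wpM2l.
rewrite mulrBr mulrBr mulrCA divff// !mulr1; lra.
Qed.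

(** The variational principle, from [gibbs] with the normalized weights [expR (- c a)]. Choosing [c]
    turns it into an entropy bound: a large constant on rare values, or the logarithm of the size of
    the class of [a]. *)
Lemma gibbs_weight (A : finType) (p c : A -> R) : is_pmf p ->
  ent p <= \sum_a p a * c a + ln (\sum_a expR (- c a)).
Proof.
move=> pp; have [p0 p1] := pp; set Z := (X in ln X).
have [a0 _] : exists a : A, True.
  apply: contrapT => h; move: p1; rewrite big1; first by move=> /esym/eqP; rewrite oner_eq0.
  by move=> a; case: h; exists a.
have Z0 : 0 < Z.
  rewrite /Z (bigD1 a0)//=; apply: ltr_pwDl; first exact: expR_gt0.
  by apply: sumr_ge0 => a _; exact: expR_ge0.
have := @gibbs A p (fun a => expR (- c a) / Z) pp.
have h1 a : 0 < expR (- c a) / Z by rewrite divr_gt0// expR_gt0.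
move=> /(_ (fun a => ltW (h1 a)))/(_ (fun a _ => h1 a)).
rewrite -mulr_suml divff ?gt_eqF// lexx => /(_ isT)/le_trans; apply.
rewrite -sumrN -[X in _ <= _ + X]mul1r -p1 mulr_suml -big_split/=.
apply: ler_sum => a _; rewrite ln_div ?posrE ?expR_gt0// expRK; lra.
Qed.

Lemma image_pmfE (A B : finType) (h : A -> B) (p : A -> R) (f : B -> R) :
  \sum_b image_pmf h p b * f b = \sum_a p a * f (h a).
Proof.
rewrite (partition_big h xpredT)//=; apply: eq_bigr => b _.
by rewrite mulr_suml; apply: eq_bigr => a /eqP ->.
Qed.

Lemma image_pmf_pmf (A B : finType) (h : A -> B) (p : A -> R) :
  is_pmf p -> is_pmf (image_pmf h p).
Proof.
move=> [p0 p1]; split; first by move=> b; exact: sumr_ge0.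
have := image_pmfE h p (fun=> 1).
by under eq_bigr do rewrite mulr1; move=> ->; under eq_bigr do rewrite mulr1.
Qed.

Lemma image_pmf_ge (A B : finType) (h : A -> B) (p : A -> R) a :
  is_pmf p -> p a <= image_pmf h p (h a).
Proof.
by move=> [p0 p1]; rewrite /image_pmf (bigD1 a)//= lerDl sumr_ge0.
Qed.

(** Merging values only raises the mass under the logarithm. *)
Lemma ent_image_le (A B : finType) (h : A -> B) (p : A -> R) : is_pmf p ->
  ent (image_pmf h p) <= ent p.
Proof.
move=> pp; rewrite /ent image_pmfE lerN2; apply: ler_sum => a _.
have [p0 _] := pp; have [->|pa] := eqVneq (p a) 0; first by rewrite !mul0r.
have pa0 : 0 < p a by rewrite lt_neqAle eq_sym pa p0.
rewrite ler_wpM2l// ler_ln ?posrE ?image_pmf_ge//.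
by rewrite (lt_le_trans pa0)// image_pmf_ge.
Qed.

Lemma ent_ge0 (A : finType) (p : A -> R) : is_pmf p -> 0 <= ent p.
Proof.
move=> pp; rewrite /ent -sumrN sumr_ge0// => a _.
by rewrite -mulrN mulr_ge0 ?pp.1// oppr_ge0 ln_le0// pmf_le1.
Qed.

Lemma ln_prod (I : finType) (f : I -> R) : (forall i, 0 < f i) ->
  ln (\prod_i f i) = \sum_i ln (f i).
Proof.
move=> f0; suff [] : ln (\prod_i f i) = \sum_i ln (f i) /\ 0 < \prod_i f i by [].
elim/big_rec2: _ => [|i y1 y2 _ [<- y0]]; first by rewrite ln1.
by rewrite mulr_gt0// lnM ?posrE.
Qed.

(** [gibbs] against the product of the marginals: its total mass is 1, and its cross entropy with
    [p] is the sum of the marginal entropies. *)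
Lemma ent_subadditive (I B : finType) (p : {ffun I -> B} -> R) : is_pmf p ->
  ent p <= \sum_i ent (image_pmf (fun w : {ffun I -> B} => w i) p).
Proof.
move=> pp; have [p0 p1] := pp.
pose m i := image_pmf (fun w : {ffun I -> B} => w i) p.
have mpmf i : is_pmf (m i) by exact: image_pmf_pmf.
have mp (w : {ffun I -> B}) i : 0 < p w -> 0 < m i (w i).
  by move=> w0; apply: lt_le_trans w0 _; exact: image_pmf_ge.
have := @gibbs _ p (fun w => \prod_i m i (w i)) pp.
have h1 w : 0 <= \prod_i m i (w i) by apply: prodr_ge0 => i _; exact: (mpmf i).1.
have h2 w : 0 < p w -> 0 < \prod_i m i (w i).
  by move=> w0; apply: prodr_gt0 => i _; exact: mp.
move=> /(_ h1 h2).
have -> : \sum_(w : {ffun I -> B}) \prod_i m i (w i) = 1.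
  rewrite -(bigA_distr_bigA (fun i b => m i b)).
  by apply: big1 => i _; exact: (mpmf i).2.
rewrite lexx => /(_ isT)/le_trans; apply.
rewrite le_eqVlt; apply/orP; left; apply/eqP.
rewrite /ent sumrN; congr (- _).
transitivity (\sum_w \sum_i p w * ln (m i (w i))).
  apply: eq_bigr => w _; have [->|pw] := eqVneq (p w) 0.
    by rewrite mul0r big1// => i; rewrite mul0r.
  have pw0 : 0 < p w by rewrite lt_neqAle eq_sym pw p0.
  by rewrite ln_prod ?mulr_sumr// => i; exact: mp.
rewrite exchange_big/=; apply: eq_bigr => i _.
by rewrite (image_pmfE _ _ (fun b => ln (m i b))).
Qed.

End FiniteEntropy.

(** * Laws of finite-valued random variables *)

Lemma fsbig_finType (V : nmodType) (A : finType) (B : pred A) (f : A -> V) :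
  \sum_(a \in [set a | B a]) f a = \sum_(a | B a) f a.
Proof.
rewrite fsbig_mkcond (fsbigE (index_enum A)) ?index_enum_uniq//; last first.
  by move=> a _; rewrite mem_index_enum.
rewrite [RHS]big_mkcond; apply: eq_big => [a|a _]; first by rewrite in_setT.
by rewrite /patch; congr (if _ then _ else _); apply/idP/idP; rewrite inE.
Qed.

Lemma fsbig_finTypeT (V : nmodType) (A : finType) (f : A -> V) :
  \sum_(a \in [set: A]) f a = \sum_a f a.
Proof. by rewrite -(fsbig_finType predT); apply: eq_fsbigl; apply/seteqP. Qed.

Section Laws.
Context (R : realType) (disp : measure_display) (T : measurableType disp).
Variable P : probability T R.

Definition discrete_rv (A : finType) (X : T -> A) : Prop :=
  forall a, measurable (X @^-1` [set a]).

Definition law (A : finType) (X : T -> A) (a : A) : R :=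
  fine (P (X @^-1` [set a])).

Lemma discrete_rv_preimage (A : finType) (X : T -> A) (B : set A) :
  discrete_rv X -> measurable (X @^-1` B).
Proof.
move=> mX; rewrite [X in measurable X](_ : _ = \bigcup_(a in B) (X @^-1` [set a])).
  by apply: fin_bigcup_measurable => //; exact: finite_finset.
by apply/seteqP; split=> [t Bt|t [a + /= Xta]]; [exists (X t)|rewrite -Xta].
Qed.

Lemma discrete_rv_comp (A B : finType) (X : T -> A) (h : A -> B) :
  discrete_rv X -> discrete_rv (h \o X).
Proof.
by move=> mX b; rewrite comp_preimage; exact: discrete_rv_preimage.
Qed.

Lemma discrete_rv_finfun (I A : finType) (Y : I -> T -> A) :
  (forall i, discrete_rv (Y i)) -> discrete_rv (fun t => [ffun i => Y i t]).
Proof.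
move=> mY w.
rewrite [X in measurable X](_ : _ = \bigcap_(i in [set: I]) (Y i @^-1` [set w i])).
  apply: fin_bigcap_measurable => [|i _]; [exact: finite_finset|exact: mY].
apply/seteqP; split=> [t /= <- i _|t h] /=; first by rewrite ffunE.
by apply/ffunP => i; rewrite ffunE; exact: h.
Qed.

Lemma law_ge0 (A : finType) (X : T -> A) a : 0 <= law X a.
Proof. by rewrite fine_ge0. Qed.

Lemma lawE (A : finType) (X : T -> A) a : discrete_rv X ->
  P (X @^-1` [set a]) = (law X a)%:E.
Proof. by move=> mX; rewrite /law fineK// fin_num_measure. Qed.

Lemma probability_preimage (A : finType) (X : T -> A) (B : pred A) :
  discrete_rv X -> P (X @^-1` [set a | B a]) = (\sum_(a | B a) law X a)%:E.
Proof.
move=> mX.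
rewrite [X in P X](_ : _ = \bigcup_(a in [set a | B a]) (X @^-1` [set a])); last first.
  by apply/seteqP; split=> [t Bt|t [a + /= Xta]]; [exists (X t)|rewrite -Xta].
rewrite measure_fin_bigcup//; last 2 first.
- exact: finite_finset.
- by move=> a b _ _ [t [<- <-]].
by rewrite fsbig_finType -sumEFin; apply: eq_bigr => a _; exact: lawE.
Qed.

Lemma law_pmf (A : finType) (X : T -> A) : discrete_rv X -> is_pmf (law X).
Proof.
move=> mX; split; first by move=> a; exact: law_ge0.
have := probability_preimage predT mX.
rewrite [X in P X](_ : _ = setT); last by apply/seteqP.
by rewrite probability_setT => -[].
Qed.

Lemma law_comp (A B : finType) (X : T -> A) (h : A -> B) : discrete_rv X ->
  law (h \o X) = image_pmf h (law X).
Proof.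
move=> mX; apply/funext => b; rewrite /law /image_pmf.
have := probability_preimage (fun a => h a == b) mX.
rewrite [X in P X](_ : _ = (h \o X) @^-1` [set b]); first by move=> ->.
by apply/seteqP; split=> t /= => [/eqP|/eqP].
Qed.

Lemma probability_set_fin (A : finType) (X : T -> A) (B : {set A}) :
  discrete_rv X -> fine (P (X @^-1` [set a | a \in B])) = \sum_(a in B) law X a.
Proof. by move=> mX; rewrite probability_preimage. Qed.

(** [S] is pinned down only up to the empty set, which [join_shifts] may contain. An empty cell
    contributes 0 and distinct values have distinct nonempty fibres, so the sum over cells is a sum
    over values. *)
Lemma partition_entropyE_law (A : finType) (X : T -> A) (S : set (set T)) :
  (forall B, S B -> B = set0 \/ exists a, B = X @^-1` [set a]) ->
  (forall a, X @^-1` [set a] !=set0 -> S (X @^-1` [set a])) ->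
  \sum_(B \in S) fine (P B) * ln (fine (P B)) = - ent (law X).
Proof.
move=> SX XS; pose A' := [set a | X @^-1` [set a] !=set0].
rewrite -(fsbig_widen ((fun a => X @^-1` [set a]) @` A')); last 2 first.
- by move=> _ [a /= Aa <-]; exact: XS.
- move=> B [/SX[->|[a ->]]]; first by rewrite /= measure0 mul0r.
  have [h|/set0P/negP/negPn/eqP ->] := pselect (X @^-1` [set a] !=set0).
    by case; exists a.
  by rewrite /= measure0 mul0r.
rewrite fsbig_image; last first.
  move=> a b /[!inE] -[t /= Xta] _ /seteqP[/(_ t)/= + _]; rewrite Xta; exact.
rewrite /ent opprK -[RHS](fsbig_finType predT).
apply: fsbig_widen => // a [_] /set0P/negP/negPn/eqP /= h.
by rewrite h measure0 mul0r.
Qed.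

Lemma ent_le_sum (I A B : finType) (f : T -> A) (Y : I -> T -> B) :
  (forall i, discrete_rv (Y i)) ->
  (forall t t', (forall i, Y i t = Y i t') -> f t = f t') ->
  ent (law f) <= \sum_i ent (law (Y i)).
Proof.
move=> mY Yf; pose J t := [ffun i => Y i t].
have mJ : discrete_rv J by exact: discrete_rv_finfun.
(* [get] picks any point of the fibre; the choice does not matter because [f] is constant on the
   fibres of [J]. *)
pose h w := f (get [set t | J t = w]).
have fE : f = h \o J.
  apply/funext => t; apply: Yf => i.
  have : [set t' | J t' = J t] (get [set t' | J t' = J t]) by apply: (@getI _ _ t).
  by move=> /= /ffunP/(_ i); rewrite !ffunE.
rewrite fE law_comp//; apply: le_trans (ent_image_le _ (law_pmf mJ)) _.
apply: le_trans (ent_subadditive (law_pmf mJ)) _.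
apply: ler_sum => i _; rewrite -law_comp//.
rewrite (_ : _ \o J = Y i)//; apply/funext => t /=.
by rewrite ffunE.
Qed.

End Laws.

(** * Borel sets and local sets of configurations *)

Section LocalSets.
Context (R : realType) (c : coordinates) (d : nat) (F : finType).
Context (hF : (1 < #|F|)%N).
Local Notation G := (lattice c d).
Local Notation Sigma := (config R c d hF).
Local Notation bor := (borel R c d hF).
Implicit Types (x y : Sigma) (A B : set Sigma).

Definition agree (n : nat) x y := forall g : G, (supnorm g < n)%N -> x g = y g.

(** These are the cylinder sets; they are stable under complement, finite union and intersection,
    and they generate the Borel sets. *)
Definition local_set (n : nat) A := forall x y, agree n x y -> A x -> A y.

Lemma agree_sym n x y : agree n x y -> agree n y x.
Proof. by move=> h g gn; rewrite h. Qed.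

Lemma agree_le m n x y : (m <= n)%N -> agree n x y -> agree m x y.
Proof. by move=> mn h g gm; apply: h; exact: leq_trans mn. Qed.

Lemma nbhs_agreeP x A : nbhs x A <-> exists n, forall y, agree n x y -> A y.
Proof.
split=> [/nbhs_ballP[e /= e0 eA]|[n nA]].
  have [k] := ltr_add_invr e0; rewrite add0r => ke.
  exists k.+1 => y xy; apply: eA; rewrite ballEmdist /=.
  apply: le_lt_trans ke; apply: (@le_trans _ _ (2 ^- k.+1)); first exact/dist_le.
  by rewrite lef_pV2 ?posrE ?exprn_gt0// -natrX ler_nat ltnW// ltn_expl.
apply/nbhs_ballP; exists (2 ^- n); first by rewrite /= invr_gt0 exprn_gt0.
by move=> y; rewrite ballEmdist /= => /ltW/dist_le; exact: nA.
Qed.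

Lemma local_set_open n A : local_set n A -> open A.
Proof.
move=> nA; rewrite openE => x Ax; apply/nbhs_agreeP; exists n => y xy.
exact: nA xy Ax.
Qed.

Lemma open_bigcup_local A : open A ->
  A = \bigcup_n [set x | forall y, agree n x y -> A y].
Proof.
rewrite openE => oA; apply/seteqP; split=> [x /oA/nbhs_agreeP[n nA]|x [n _]].
  by exists n.
exact.
Qed.

Lemma local_set_interior n A : local_set n [set x | forall y, agree n x y -> A y].
Proof.
by move=> x y xy xA z yz; apply: xA => g gn; rewrite xy// yz.
Qed.

Lemma local_setC n A : local_set n A -> local_set n (~` A).
Proof. by move=> nA x y xy; apply: contra_not; apply: nA; exact: agree_sym. Qed.

Lemma local_setU m n A B : local_set m A -> local_set n B ->
  local_set (maxn m n) (A `|` B).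
Proof.
move=> mA nB x y xy [Ax|Bx]; [left; apply: mA Ax|right; apply: nB Bx];
  by apply: agree_le xy; rewrite ?leq_maxl ?leq_maxr.
Qed.

Lemma local_setI m n A B : local_set m A -> local_set n B ->
  local_set (maxn m n) (A `&` B).
Proof.
move=> mA nB x y xy [Ax Bx]; split; [apply: mA Ax|apply: nB Bx];
  by apply: agree_le xy; rewrite ?leq_maxl ?leq_maxr.
Qed.

Lemma measurable_local n A : local_set n A -> measurable (A : set bor).
Proof. by move=> nA; apply: sub_sigma_algebra; exact: local_set_open nA. Qed.

(** * Approximation of Borel sets by local sets *)

Section Approximation.
Variable rho : probability bor R.

Definition approximable (A : set bor) := measurable A /\
  forall e : R, 0 < e -> exists n B, local_set n B /\ (rho (A `+` B) < e%:E)%E.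

Lemma approximable_local n A : local_set n A -> approximable A.
Proof.
move=> nA; split; first exact: measurable_local nA.
move=> e e0; exists n, A; split => //.
by rewrite setYK measure0 lte_fin.
Qed.

Lemma measurableY (A B : set bor) : measurable A -> measurable B ->
  measurable (A `+` B).
Proof.
by move=> mA mB; rewrite setY_def; apply: measurableU; apply: measurableD.
Qed.

Lemma approximableC A : approximable A -> approximable (~` A).
Proof.
move=> [mA hA]; split; first exact: measurableC.
move=> e /hA[n [B [nB AB]]]; exists n, (~` B); split; first exact: local_setC.
rewrite (_ : _ `+` _ = A `+` B)// !setY_def.
by apply/seteqP; split=> t /= [[h1 h2]|[h1 h2]]; [right|left|right|left];
  split => //; apply: contrapT.
Qed.

Lemma approximableU A B : approximable A -> approximable B ->
  approximable (A `|` B).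
Proof.
move=> [mA hA] [mB hB]; split; first exact: measurableU.
move=> e e0; have e2 : 0 < e / 2 by rewrite divr_gt0.
have [m [A' [lA AA']]] := hA _ e2; have [n [B' [lB BB']]] := hB _ e2.
exists (maxn m n), (A' `|` B'); split; first exact: local_setU.
have mA' := measurable_local lA; have mB' := measurable_local lB.
apply: (@le_lt_trans _ _ (rho ((A `+` A') `|` (B `+` B')))).
  apply: le_measure; rewrite ?inE.
  - by apply: measurableY; apply: measurableU.
  - by apply: measurableU; apply: measurableY.
  rewrite !setY_def => t /= [[[h|h] /not_orP[h1 h2]]|[[h|h] /not_orP[h1 h2]]];
    tauto.
apply: le_lt_trans (measureU2 _ _ _) _; [exact: measurableY|exact: measurableY|].
by rewrite [e]splitr EFinD lteD.
Qed.

(** The part of the union missed by its first [k] terms decreases to the empty set, so continuity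
    from above makes its mass less than [e / 2] for some [k]; the finite union is approximated
    within the other half. *)
Lemma approximable_bigcup (A : nat -> set bor) : (forall i, approximable (A i)) ->
  approximable (\bigcup_i A i).
Proof.
move=> hA; have mU : measurable (\bigcup_i A i).
  by apply: bigcup_measurable => i _; exact: (hA i).1.
split => // e e0; have e2 : 0 < e / 2 by rewrite divr_gt0.
pose U k := \big[setU/set0]_(i < k) A i.
have hU k : approximable (U k).
  rewrite /U; elim: k => [|k ih]; last by rewrite big_ord_recr; exact: approximableU.
  by rewrite big_ord0; apply: (@approximable_local 0).
pose D k := (\bigcup_i A i) `\` U k.
have mD k : measurable (D k) by apply: measurableD => //; exact: (hU k).1.
have : rho \o D @ \oo --> rho (\bigcap_k D k).
  apply: nonincreasing_cvg_mu => //.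
  - by apply: le_lt_trans (probability_le1 _ (mD 0%N)) _; rewrite ltry.
  - exact: bigcap_measurable.
  - move=> m n mn; rewrite subsetEset; apply: setDS.
    exact: subset_bigsetU.
rewrite (_ : \bigcap_k D k = set0); last first.
  rewrite -subset0 => t Dt; have [i _ Ait] := (Dt 0%N I).1.
  have := (Dt i.+1 I).2; apply.
  by rewrite /U -bigcup_mkord; exists i => /=.
rewrite measure0 => /fine_cvgP[_ /cvgrPdist_lt/(_ _ e2)[k _ /(_ k (leqnn k))]] /=.
rewrite sub0r normrN ger0_norm ?fine_ge0// => hk.
have [n [B [nB UB]]] := (hU k).2 _ e2.
exists n, B; split => //.
have mB := measurable_local nB.
apply: (@le_lt_trans _ _ (rho (D k `|` (U k `+` B)))).
  apply: le_measure; rewrite ?inE.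
  - exact: measurableY.
  - by apply: measurableU => //; apply: measurableY => //; exact: (hU k).1.
  rewrite !setY_def => t /= [[h1 h2]|[h1 h2]].
    by have [Ut|Ut] := pselect (U k t); [right; left|left].
  right; right; split=> // Ut; apply: h2; move: Ut.
  by rewrite /U -bigcup_mkord => -[i _ At]; exists i.
apply: le_lt_trans (measureU2 _ _ _) _; [by []|by apply: measurableY => //; exact: (hU k).1|].
rewrite [e]splitr EFinD lteD//.
by rewrite -[X in (X < _)%E]fineK ?lte_fin// fin_num_measure.
Qed.

Lemma measurable_approximable (A : set bor) : measurable A -> approximable A.
Proof.
move: A; suff : <<s @open Sigma >> `<=` approximable by exact.
apply: smallest_sub; first split.
- by apply: (@approximable_local 0).
- by move=> A hA; rewrite setTD; exact: approximableC.
- by move=> A hA; exact: approximable_bigcup.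
move=> A /open_bigcup_local ->; apply: approximable_bigcup => n.
exact: approximable_local (@local_set_interior n A).
Qed.

End Approximation.

(** Local sets form a generating pi-system that contains the whole space. *)
Lemma local_measure_unique (mu nu : probability bor R) :
  (forall n A, local_set n A -> mu A = nu A) ->
  forall A : set bor, measurable A -> mu A = nu A.
Proof.
move=> h A mA.
pose L := [set B : set bor | exists n, local_set n B].
apply: (measure_unique L (fun=> setT)) => //.
- apply/seteqP; split.
    apply: smallest_sub.
      exact: smallest_sigma_algebra.
    move=> B /open_bigcup_local ->; apply: sigma_algebra_bigcup => n.
    by apply: sub_sigma_algebra; exists n; exact: local_set_interior.
  apply: smallest_sub; first exact: sigma_algebra_measurable.
  by move=> B [n nB]; exact: measurable_local nB.
- by move=> B1 B2 [m h1] [n h2]; exists (maxn m n); exact: local_setI.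
- by move=> _; exists 0%N.
- by rewrite bigcup_const//; exists 0%N.
- by move=> B [n nB]; exact: h nB.
- by move=> _; change (mu setT < +oo)%E; rewrite probability_setT ltry.
Qed.

End LocalSets.

(** * Boxes and tilings *)

Definition coord_int (c : coordinates) : coord_type c -> int :=
  match c with CoordZ => id | CoordN => Posz end.

Definition coord_nat (c : coordinates) : nat -> coord_type c :=
  match c with CoordZ => Posz | CoordN => id end.

(* [coord_abs x < n.+1] has [coord_count n] solutions, listed by [coord_enum n]. *)
Definition coord_count (c : coordinates) (n : nat) : nat :=
  match c with CoordZ => n.*2.+1 | CoordN => n.+1 end.

Definition coord_enum (c : coordinates) (n : nat) : nat -> coord_type c :=
  match c with CoordZ => fun k => Posz k - Posz n | CoordN => id end.

Section Coordinates.
Context (c : coordinates).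
Implicit Types x y : coord_type c.

Lemma coord_int0 : @coord_int c 0 = 0.
Proof. by rewrite /coord_int; case: c. Qed.

Lemma coord_intD x y : coord_int (x + y) = coord_int x + coord_int y.
Proof. by rewrite /coord_int; case: c x y. Qed.

Lemma coord_int_inj : injective (@coord_int c).
Proof. by rewrite /coord_int; case: c => x y // []. Qed.

Lemma coord_intK k : coord_int (coord_nat c k) = k.
Proof. by rewrite /coord_int /coord_nat; case: c. Qed.

Lemma coord_absE (x : coord_type c) : coord_abs x = `|coord_int x|%N.
Proof. by rewrite /coord_abs /coord_int; case: c x. Qed.

(** Division with remainder, rounding down, so that the remainder is a step available in N_0 as
    well. Rounding a negative integer down moves it away from 0, whence the [+ M] in the bound. *)
Lemma coord_floor (M : nat) (x : coord_type c) : (0 < M)%N ->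
  exists y r, [/\ (r < M)%N, x = y + coord_nat c r, (M %| coord_int y)%Z
    & (coord_abs y <= coord_abs x + M)%N].
Proof.
move=> M0; case: c x => /= x; last first.
  exists (x - x %% M)%N, (x %% M)%N; split; first exact: ltn_pmod.
  - by rewrite -[LHS](@subnK (x %% M)%N) ?leq_mod.
  - apply/dvdzP; exists (Posz (x %/ M)); rewrite -PoszM; congr Posz.
    by rewrite {1}(divn_eq x M) addnK.
  - by rewrite /coord_abs; lia.
have M0' : (M : int) != 0 by rewrite -lt0n.
exists ((x %/ M)%Z * M), `|(x %% M)%Z|%N.
have r0 : (0 <= x %% M)%Z by exact: modz_ge0.
have xE := divz_eq x M.
split.
- by lia.
- by rewrite /coord_nat gez0_abs.
- by rewrite /coord_int dvdz_mull.
- by rewrite /coord_abs; lia.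
Qed.

Lemma coord_enum_inj n : injective (coord_enum c n).
Proof. by rewrite /coord_enum; case: c => // x y /addIr[]. Qed.

Lemma coord_enumP n (x : coord_type c) : reflect
  (exists2 k : 'I_(coord_count c n), true & x = coord_enum c n k) (coord_abs x <= n)%N.
Proof.
rewrite /coord_abs /coord_enum /coord_count; case: c x => x.
  apply: (iffP idP) => [xn|[[k kn] _ ->] /=]; last by lia.
  have h : (`|((x : int) + Posz n)%R| < n.*2.+1)%N by lia.
  by exists (Ordinal h) => //=; lia.
apply: (iffP idP) => [xn|[[k kn] _ ->]//].
by exists (Ordinal (xn : (x < n.+1)%N)).
Qed.

Lemma coord_count_le n k : (coord_count c (n + k) <= coord_count c n + k.*2)%N.
Proof. by rewrite /coord_count; case: c; lia. Qed.

Lemma coord_count_gt n : (n < coord_count c n)%N.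
Proof. by rewrite /coord_count; case: c; lia. Qed.

End Coordinates.

Section Boxes.
Context (c : coordinates) (d : nat) (hd : (1 <= d)%N).
Local Notation G := (lattice c d).
Implicit Types g h : G.
Local Open Scope nat_scope.

Definition i0 : 'I_d := Ordinal hd.

Definition height g : int := coord_int (g i0).

Definition axis (k : nat) : G :=
  [ffun i => if i == i0 then coord_nat c k else 0%R].

Lemma supnorm_leP g n :
  reflect (forall i, coord_abs (g i) <= n) (supnorm g <= n).
Proof.
apply: (iffP (bigmax_leqP _ _ _)) => h i; first exact: (h i isT).
by move=> _; exact: h.
Qed.

Lemma heightD g h : height (g + h)%R = (height g + height h)%R.
Proof. by rewrite /height ffunE coord_intD. Qed.

Lemma height_axis k : height (axis k) = k.
Proof. by rewrite /height ffunE eqxx coord_intK. Qed.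

Lemma supnormD g h : supnorm (g + h)%R <= supnorm g + supnorm h.
Proof.
apply/supnorm_leP => i; rewrite ffunE.
have /supnorm_leP/(_ i) := leqnn (supnorm g).
have /supnorm_leP/(_ i) := leqnn (supnorm h).
rewrite !coord_absE coord_intD.
move: (coord_int (h i)) (coord_int (g i)) (supnorm g) (supnorm h) => a b m n; clear; lia.
Qed.

Lemma supnorm_axis k : supnorm (axis k) = k.
Proof.
apply/eqP; rewrite eqn_leq; apply/andP; split.
  apply/supnorm_leP => i; rewrite ffunE; case: ifP => _.
    by rewrite coord_absE coord_intK.
  by rewrite coord_absE coord_int0.
have /supnorm_leP/(_ i0) := leqnn (supnorm (axis k)).
by rewrite coord_absE ffunE eqxx coord_intK.
Qed.

Lemma lattice_addI g : injective (fun h => g + h)%R.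
Proof.
move=> h h' /ffunP hh'; apply/ffunP => i; apply: coord_int_inj.
by have := congr1 (@coord_int c) (hh' i); rewrite !ffunE !coord_intD => /addrI.
Qed.

Lemma lattice_addIr g : injective (fun h => h + g)%R.
Proof. by move=> h h'; rewrite ![(_ + g)%R]addrC; exact: lattice_addI. Qed.

Lemma axis_inj : injective axis.
Proof. by move=> k l /(congr1 height); rewrite !height_axis => -[]. Qed.

Lemma cell_decomp M g : 0 < M -> exists h r, [/\ r < M, g = (h + axis r)%R,
  (M %| height h)%Z & supnorm h <= supnorm g + M].
Proof.
move=> M0; have [y [r [rM gE My yg]]] := coord_floor (g i0) M0.
exists [ffun i => if i == i0 then y else g i], r; split => //.
- by apply/ffunP => i; rewrite !ffunE; case: eqP => [->//|_]; rewrite addr0.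
- by rewrite /height ffunE eqxx.
apply/supnorm_leP => i; rewrite ffunE.
have /supnorm_leP hg := leqnn (supnorm g).
case: eqP => _; last by rewrite (leq_trans (hg i))// leq_addr.
by rewrite (leq_trans yg)// leq_add2r.
Qed.

Lemma box_fset n : [set` imfset imfset_key (fun w : {ffun 'I_d -> 'I_(coord_count c n)} =>
    [ffun i => coord_enum c n (w i)] : G) (mem predT)] = @box c d n.+1.
Proof.
apply/seteqP; split=> g /=.
  move=> /imfsetP[w _ ->]; rewrite /box /= ltnS; apply/supnorm_leP => i.
  by apply/coord_enumP; exists (w i) => //; rewrite ffunE.
rewrite /box /= ltnS => /supnorm_leP hg.
have /choice[w wE] : forall i, exists k : 'I_(coord_count c n), g i = coord_enum c n k.
  by move=> i; have /coord_enumP[k _ ->] := hg i; exists k.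
apply/imfsetP; exists [ffun i => w i] => //.
by apply/ffunP => i; rewrite ffunE ffunE.
Qed.

Lemma finite_box n : finite_set (@box c d n).
Proof.
case: n => [|n]; last by rewrite -box_fset; exact: finite_fset.
by rewrite (_ : box _ = set0)//; apply/seteqP; split.
Qed.

Definition fbox n : {fset G} := fset_set (@box c d n).

Lemma in_fbox n g : (g \in fbox n) = (supnorm g < n).
Proof. by rewrite in_fset_set; [apply/idP/idP; rewrite inE|exact: finite_box]. Qed.

Lemma card_fbox n : #|` fbox n.+1| = coord_count c n ^ d.
Proof.
rewrite /fbox -box_fset set_fsetK card_imfset /=.
  by rewrite -cardE card_ffun !card_ord.
move=> w w' /ffunP ww'; apply/ffunP => i; apply/val_inj.
by have := ww' i; rewrite !ffunE => /coord_enum_inj.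
Qed.

Lemma card_fbox_gt0 n : 0 < #|` fbox n.+1|.
Proof. by rewrite card_fbox expn_gt0 (leq_ltn_trans _ (coord_count_gt c n)). Qed.

(** Starting points of the segments of length [M] that tile the lattice along the first axis. The
    radius [n + M] leaves room for rounding down from a site of the box of radius [n]. *)
Definition corners M n : {fset G} :=
  [fset g in fbox (n + M) | (M %| height g)%Z]%fset.

Lemma in_corners M n h :
  (h \in corners M n) = (supnorm h < n + M) && (M %| height h)%Z.
Proof. by rewrite -in_fbox !inE. Qed.

Lemma corners_cover M n g : 0 < M -> g \in fbox n ->
  exists2 h, h \in corners M n & exists2 r, r < M & g = (h + axis r)%R.
Proof.
move=> M0; rewrite in_fbox => gn; have [h [r [rM gE Mh hg]]] := cell_decomp g M0.
exists h; last by exists r.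
by rewrite in_corners Mh andbT (leq_ltn_trans hg)// ltn_add2r.
Qed.

(** The segments starting at distinct corners are disjoint, and they stay inside the box enlarged
    once more by [M]. *)
Lemma card_corners M n : 0 < M -> #|` corners M n| * M <= #|` fbox (n + M + M)|.
Proof.
move=> M0; pose f (u : corners M n * 'I_M) : G := (val u.1 + axis u.2)%R.
have fI : injective f.
  move=> [[h hc] r] [[h' h'c] r']; rewrite /f /= => hr.
  have : height (h + axis r)%R = height (h' + axis r')%R by rewrite hr.
  have [q hq] : exists q : int, height h = (q * Posz M)%R.
    by have := hc; rewrite in_corners => /andP[_ /dvdzP].
  have [q' hq'] : exists q : int, height h' = (q * Posz M)%R.
    by have := h'c; rewrite in_corners => /andP[_ /dvdzP].
  rewrite !heightD !height_axis hq hq' => e.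
  have qq : q = q'.
    have [] := (ltn_ord r, ltn_ord r'); move: e; move: (nat_of_ord r) (nat_of_ord r').
    by move=> a b; nia.
  have rr : r = r' by apply/val_inj => /=; move: e; rewrite qq; lia.
  move: hr; rewrite rr => /lattice_addIr hh'; congr pair; exact/val_inj.
have -> : #|` corners M n| * M = #|` imfset imfset_key f (mem predT)|.
  by rewrite [RHS]card_imfset//= -cardE card_prod card_ord [in LHS]cardfE.
apply: fsubset_leq_card; apply/fsubsetP => _ /imfsetP[[[h hc] r] _ ->].
have hn : supnorm h < n + M by have := hc; rewrite in_corners => /andP[].
rewrite /f in_fbox /=.
by rewrite (leq_ltn_trans (supnormD _ _))// supnorm_axis -addSn leq_add// ltnW.
Qed.

Definition residue_box p (q : int) n : {fset G} :=
  [fset g in fbox n | (p %| (height g - q)%R)%Z]%fset.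

Lemma in_residue_box p q n g :
  (g \in residue_box p q n) = (supnorm g < n) && (p %| (height g - q)%R)%Z.
Proof. by rewrite -in_fbox !inE. Qed.

(** One of the [p] translations along the axis brings a given site to a height congruent to [q], and
    each translation is injective. They all go upwards, so that they exist in N_0. *)
Lemma card_residue_box p q n : 0 < p ->
  #|` fbox n| <= p * #|` residue_box p q (n + p)|.
Proof.
move=> p0; pose S j := [fset g in fbox n | (p %| (height (g + axis j) - q)%R)%Z]%fset.
have cS j : j < p -> #|` S j| <= #|` residue_box p q (n + p)|.
  move=> jp; have <- : #|` [fset (g + axis j)%R | g in S j]%fset| = #|` S j|.
    by rewrite (card_imfset _ _ (@lattice_addIr (axis j))).
  apply: fsubset_leq_card; apply/fsubsetP => _ /imfsetP[g /= gS ->].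
  have [gn hg] : supnorm g < n /\ (p %| (height (g + axis j) - q)%R)%Z.
    by move: gS; rewrite -in_fbox !inE => /andP[].
  rewrite in_residue_box hg andbT.
  by rewrite (leq_ltn_trans (supnormD _ _))// supnorm_axis -addSn leq_add// ltnW.
apply: (@leq_trans (\sum_(j < p) #|` S j|)); last first.
  rewrite -[p in p * _]card_ord -sum_nat_const; apply: leq_sum => j _.
  exact: cS.
have sub : (fbox n `<=` \big[fsetU/fset0]_(j : 'I_p) S j)%fset.
  apply/fsubsetP => g gn.
  have jp : `|((q - height g)%R %% p)%Z|%N < p by lia.
  apply/bigfcupP; exists (Ordinal jp); first by rewrite mem_index_enum.
  rewrite !inE /= gn /= heightD height_axis /=.
  apply/dvdzP; exists (- ((q - height g)%R %/ p)%Z)%R.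
  by have := divz_eq (q - height g)%R p; lia.
apply: leq_trans (fsubset_leq_card sub) _.
elim: (index_enum _) => [|j s ih]; first by rewrite !big_nil cardfs0.
by rewrite !big_cons (leq_trans (leq_card_fsetU _ _).1)// leq_add2l.
Qed.

Section Growth.
Context (R : realType).
Local Open Scope ring_scope.

(** The ratio of the two cardinals is at most the [d]-th power of [1 + 2 k / n], which tends to 1:
    boundary effects are negligible. *)
Lemma fbox_growth k (e : R) : 0 < e -> \forall n \near \oo,
  #|` fbox (n + k)|%:R <= (1 + e) * #|` fbox n|%:R :> R.
Proof.
move=> e0.
suff [N _ hN] : \forall n \near \oo,
    #|` fbox (n.+1 + k)|%:R <= (1 + e) * #|` fbox n.+1|%:R :> R.
  by exists N.+1 => // -[//|n] /=; rewrite ltnS => /hN.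
have h : (fun n => (1 + k.*2%:R * harmonic n) ^+ d : R) @ \oo --> (1 + k.*2%:R * 0 : R) ^+ d.
  apply: (@continuous_cvg _ _ _ _ _ _ (fun x : R => x ^+ d)).
    exact: exprn_continuous.
  by apply: cvgD; [exact: cvg_cst|apply: cvgM; [exact: cvg_cst|exact: cvg_harmonic]].
rewrite mulr0 addr0 expr1n in h.
have := cvgr_lt _ h (1 + e); rewrite ltrDl e0 => /(_ _ isT).
apply: filterS => n /ltW hn; rewrite addSn !card_fbox.
rewrite -ler_pdivrMr ?ltr0n ?expn_gt0 ?(leq_ltn_trans _ (coord_count_gt c n))//.
apply: le_trans hn; rewrite !natrX -expr_div_n; apply: lerXn2r.
- by rewrite nnegrE divr_ge0.
- by rewrite nnegrE addr_ge0// mulr_ge0// harmonic_ge0.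
rewrite ler_pdivrMr ?ltr0n ?(leq_ltn_trans _ (coord_count_gt c n))//.
apply: (@le_trans _ _ (coord_count c n + k.*2)%:R).
  by rewrite ler_nat coord_count_le.
rewrite natrD mulrDl mul1r lerD2l -mulrA ler_peMr// /harmonic /=.
by rewrite mulrC ler_pdivlMr ?mul1r ?ltr0n// ler_nat coord_count_gt.
Qed.

Lemma corners_density k M (h e : R) : (0 < M)%N -> 0 <= h -> 0 < e ->
  \forall n \near \oo,
    #|` corners M (n + k)|%:R * h <= (h / M%:R + e) * #|` fbox n|%:R.
Proof.
move=> M0 h0 e0; have M0' : 0 < M%:R :> R by rewrite ltr0n.
have hM0 : 0 <= h / M%:R by rewrite divr_ge0.
(* Chosen so that [e' * (h / M)] is at most [e]; the added 1 covers the case where [h] is 0. *)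
pose e' : R := e / (h / M%:R + 1).
have e'0 : 0 < e' by rewrite divr_gt0// ltr_wpDl.
near=> n.
have hc : #|` corners M (n + k)|%:R * M%:R <= (1 + e') * #|` fbox n|%:R.
  apply: (@le_trans _ _ #|` fbox (n + (k + M + M))|%:R).
    by rewrite -natrM ler_nat !addnA card_corners.
  by near: n; exact: fbox_growth.
have := ler_wpM2r hM0 hc.
rewrite -[leLHS]mulrA [X in _ * X]mulrC divfK ?gt_eqF// => /le_trans; apply.
rewrite mulrAC ler_wpM2r ?ler0n// mulrDl mul1r lerD2l.
by rewrite /e' mulrAC ler_pdivrMr ?ltr_wpDl// ler_wpM2l ?(ltW e0)//; lra.
Unshelve. all: by end_near.
Qed.

End Growth.
End Boxes.

(** * The entropy of an invariant measure is at most that of a window *)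

Lemma discrete_rv_pair (disp : measure_display) (T : measurableType disp)
    (A B : finType) (X : T -> A) (Y : T -> B) :
  discrete_rv X -> discrete_rv Y -> discrete_rv (fun t => (X t, Y t)).
Proof.
move=> mX mY [a b].
rewrite [X in measurable X](_ : _ = (X @^-1` [set a]) `&` (Y @^-1` [set b])).
  exact: measurableI.
by apply/seteqP; split=> t /= [-> ->].
Qed.

(** The limit of a divergent sequence is the default value 0, which is why [l] is taken
    nonnegative. *)
Lemma limn_le (R : realType) (u : nat -> R) (l : R) : 0 <= l ->
  (forall e, 0 < e -> \forall n \near \oo, u n <= l + e) -> limn u <= l.
Proof.
move=> l0 h; have [cu|/dvgP ->] := pselect (cvgn u); last by [].
apply/ler_addgt0Pr => e e0.
by apply: limr_le => //; exact: h.
Qed.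

Section Windows.
Context (R : realType) (c : coordinates) (d : nat) (hd : (1 <= d)%N).
Context (F : finType) (hF : (1 < #|F|)%N).
Local Notation G := (lattice c d).
Local Notation Sigma := (config R c d hF).
Local Notation bor := (borel R c d hF).
Local Notation shft g := (@shift R c d F hF g : bor -> bor).
Implicit Types (x y : Sigma) (n M : nat).

Definition pattern (S : {fset G}) (x : bor) : {ffun S -> F} :=
  [ffun g => x (val g)].

Definition window M (x : bor) : {ffun 'I_M -> F} :=
  [ffun k => x (axis c hd (val k))].

Lemma discrete_rv_local (A : finType) (X : bor -> A) n :
  (forall x y, agree n x y -> X x = X y) -> discrete_rv X.
Proof.
move=> nX a; apply: (@measurable_local _ _ _ _ _ n) => x y xy /= <-.
by apply/esym/nX.
Qed.

Lemma discrete_rv_coordinate g : discrete_rv (fun x : bor => x g).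
Proof. by apply: (@discrete_rv_local _ _ (supnorm g).+1) => x y; apply. Qed.

Lemma discrete_rv_pattern S : discrete_rv (pattern S).
Proof. by apply: discrete_rv_finfun => g; exact: discrete_rv_coordinate. Qed.

Lemma discrete_rv_window M : discrete_rv (window M).
Proof. by apply: discrete_rv_finfun => g; exact: discrete_rv_coordinate. Qed.

Lemma agree_shift n g x y : agree (n + supnorm g) x y ->
  agree n (@shift R c d F hF g x) (@shift R c d F hF g y).
Proof.
move=> xy h hn; apply: xy; rewrite (leq_ltn_trans (supnormD _ _))//.
by rewrite addnC ltn_add2r.
Qed.

Lemma measurable_shift g (A : set bor) : measurable A ->
  measurable (shft g @^-1` A : set bor).
Proof.
move=> mA; rewrite -[X in measurable X]setTI.
apply: (@measurability _ _ bor bor setT (shft g) (@open Sigma)) => //.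
move=> _ [B oB <-]; rewrite setTI (open_bigcup_local oB) preimage_bigcup.
apply: bigcup_measurable => n _.
apply: (@measurable_local _ _ _ _ _ (n + supnorm g)) => x y /agree_shift xy.
exact: local_set_interior xy.
Qed.

Lemma discrete_rv_shift (A : finType) (X : bor -> A) g :
  discrete_rv X -> discrete_rv (X \o shft g).
Proof. by move=> mX a; rewrite comp_preimage; exact: measurable_shift. Qed.

Section Invariant.
Variable rho : probability bor R.
Hypothesis rho_inv : shift_invariant rho.

Lemma law_shift (A : finType) (X : bor -> A) g : discrete_rv X ->
  law rho (X \o shft g) = law rho X.
Proof.
by move=> mX; apply/funext => a; rewrite /law comp_preimage rho_inv.
Qed.

Lemma ent_law_comp_le (A B : finType) (X : bor -> A) (h : A -> B) :
  discrete_rv X -> ent (law rho (h \o X)) <= ent (law rho X).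
Proof. by move=> mX; rewrite law_comp// ent_image_le//; exact: law_pmf. Qed.

Lemma ent_window_ge0 M : 0 <= ent (law rho (window M)).
Proof. by apply: ent_ge0; apply: law_pmf; exact: discrete_rv_window. Qed.

(** The windows at the corners cover the box, and by invariance each has the law of the window at
    the origin. *)
Lemma ent_pattern_le n M : (0 < M)%N ->
  ent (law rho (pattern (fbox c d n))) <=
  #|` corners c hd M n|%:R * ent (law rho (window M)).
Proof.
move=> M0.
pose Y (h : corners c hd M n) := window M \o shft (val h).
have mY h : discrete_rv (Y h).
  by apply: discrete_rv_shift; exact: discrete_rv_window.
apply: le_trans (ent_le_sum rho mY _) _.
  move=> x y xy; apply/ffunP => -[g gn]; rewrite !ffunE /=.
  have [h hc [r rM ->]] := corners_cover hd M0 gn.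
  by have /ffunP/(_ (Ordinal rM)) := xy [` hc]%fset; rewrite !ffunE.
have lY h : law rho (Y h) = law rho (window M).
  by apply: law_shift; exact: discrete_rv_window.
under eq_bigr => h _ do rewrite lY.
by rewrite sumr_const -cardfE mulr_natl.
Qed.

(** * Entropy with respect to an arbitrary finite partition *)

Section Partition.
Variable P : set (set bor).
Hypothesis finP : finite_measurable_partition P.
Let K := fset_set P.

Lemma partition_index : exists idx : bor -> K,
  discrete_rv idx /\ forall a, idx @^-1` [set a] = val a.
Proof.
have [Pfin [Pcov Ptriv Pne] Pm] := finP.
have : forall x : bor, exists a : K, val a x.
  move=> x; have : [set: bor] x by []; rewrite -Pcov => -[A PA Ax].
  have AK : A \in K by rewrite in_fset_set// inE.
  by exists [` AK]%fset.
move=> /choice[idx idxE].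
have PK (a : K) : P (val a).
  by have := valP a; rewrite in_fset_set// inE.
have idxP a : idx @^-1` [set a] = val a.
  apply/seteqP; split=> [x /= <-|x ax] /=; first exact: idxE.
  apply/val_inj; apply: (Ptriv _ _ (PK _) (PK _)).
  by exists x; split => //; exact: idxE.
by exists idx; split => // a; rewrite idxP; apply: Pm; exact: PK.
Qed.

Lemma partition_entropy_join (idx : bor -> K) n :
  discrete_rv idx -> (forall a, idx @^-1` [set a] = val a) ->
  partition_entropy rho (join_shifts (@box c d n) P) =
  ent (law rho (fun x => [ffun g : fbox c d n => idx (@shift R c d F hF (val g) x)])).
Proof.
have [Pfin _ _] := finP => midx idxP.
rewrite /partition_entropy.
set X := fun x : bor => _.
rewrite (@partition_entropyE_law _ _ _ rho _ X) ?opprK//.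
- move=> B [A [PA ->]]; right.
  have AK g : A g \in K by rewrite in_fset_set// inE.
  exists [ffun g => [` AK (val g)]%fset].
  have AE g x : (@shift R c d F hF g @^-1` A g) x <-> idx (@shift R c d F hF g x) = [` AK g]%fset.
    by have /seteqP[h1 h2] := idxP [` AK g]%fset; split; [exact: h2|exact: h1].
  apply/seteqP; split=> [x /= hx|x /= hx g gn].
    apply/ffunP => g; rewrite !ffunE; apply/AE; apply: hx.
    by have := valP g; rewrite in_fbox.
  have gn' : g \in fbox c d n by rewrite in_fbox.
  by apply/AE; have /ffunP/(_ [` gn']%fset) := hx; rewrite !ffunE.
- move=> w _.
  (* [join_shifts] asks for a cell at every site; outside the box any cell of [P] will do. *)
  pose A g := if insub g is Some g' then val (w g') else val (idx point).
  exists A; split.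
    move=> g; rewrite /A; case: insubP => [g' _ _|_].
      by have := valP (w g'); rewrite in_fset_set// inE.
    by have := valP (idx point); rewrite in_fset_set// inE.
  apply/seteqP; split=> [x /= Xw g gn|x /= hx].
    have gn' : g \in fbox c d n by rewrite in_fbox.
    by rewrite /preimage /A /= insubT -Xw ffunE -idxP.
  apply/ffunP => g; rewrite ffunE.
  have gn : @box c d n (val g) by have := valP g; rewrite in_fbox.
  by have := hx _ gn; rewrite /A /= valK -idxP.
Qed.

(** Each cell is replaced by a nearby local set, and [f] picks a cell whose local set contains the
    point. If [f] errs at [x], then [x] is in the symmetric difference of some cell and its local
    set; the masses of these differences add up to at most [e]. *)
Lemma partition_local_approx (idx : bor -> K) (e : R) :
  discrete_rv idx -> (forall a, idx @^-1` [set a] = val a) -> 0 < e ->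
  exists k (f : bor -> K), (forall x y : Sigma, agree k x y -> f x = f y) /\
    (rho [set x | idx x != f x] <= e%:E)%E.
Proof.
move=> midx idxP e0.
have K0 : (0 < #|{: K}|)%N by apply/card_gt0P; exists (idx point).
have eK : 0 < e / #|{: K}|%:R by rewrite divr_gt0// ltr0n.
pose Q (a : K) (nB : nat * set bor) :=
  @local_set R c d F hF nB.1 nB.2 /\ (rho (val a `+` nB.2) < (e / #|{: K}|%:R)%:E)%E.
have [nB hB] : {nB : K -> nat * set bor & forall a, Q a (nB a)}.
  apply: choice => a; have ma : measurable (val a) by rewrite -idxP; exact: midx.
  have [n [B [lB hB]]] := (measurable_approximable rho ma).2 _ eK.
  by exists (n, B).
pose k := \max_a (nB a).1.
pose f (x : bor) := odflt (idx point) [pick a | `[< (nB a).2 x >]].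
have fk (x y : Sigma) : agree k x y -> f x = f y.
  move=> xy; rewrite /f; congr odflt; apply: eq_pick => a /=.
  have xya : agree (nB a).1 x y by apply: agree_le xy; exact: leq_bigmax.
  apply/asboolP/asboolP; apply: (hB a).1 => //; exact: agree_sym.
exists k, f; split => //.
have mY (a : K) : measurable (val a `+` (nB a).2).
  apply: measurableY; first by rewrite -idxP; exact: midx.
  exact: measurable_local (hB a).1.
have mE : measurable [set x | idx x != f x].
  rewrite (_ : [set x | _] = (fun x => (idx x, f x)) @^-1` [set u | u.1 != u.2])//.
  apply: discrete_rv_preimage; apply: discrete_rv_pair => //.
  exact: discrete_rv_local fk.
have sub : [set x | idx x != f x] `<=`
    \bigcup_(a in [set: K]) (val a `+` (nB a).2).
  move=> x /= idxf.
  have ix : val (idx x) x by rewrite -idxP.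
  have [Bx|Bx] := pselect ((nB (idx x)).2 x); last first.
    by exists (idx x) => //; rewrite setY_def; left.
  have := erefl (f x); rewrite {1}/f; case: pickP => [a /asboolP Bax /= aE|/(_ (idx x))]; last first.
    by move=> /asboolP.
  exists a => //; rewrite setY_def; right; split => //.
  rewrite -idxP /= => ia; move: idxf; rewrite -aE ia eqxx//.
have fK : finite_set [set: K] by exact: finite_finset.
have := content_sub_fsum rho fK (fun a _ => mY a) mE sub.
move=> /le_trans; apply.
rewrite fsbig_finTypeT.
apply: (@le_trans _ _ (\sum_(a : K) (e / #|{: K}|%:R)%:E)%E).
  by apply: lee_sum => a _; exact: ltW (hB a).2.
by rewrite sumEFin lee_fin sumr_const -[leLHS]mulr_natr divfK// pnatr_eq0 -lt0n.
Qed.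


(** The correction to the guess [f]: together with [f] it determines [idx], and it is [None]
    wherever the guess is right. *)
Definition mismatch (idx f : bor -> K) (x : bor) : option K :=
  if idx x == f x then None else Some (idx x).

Lemma discrete_rv_mismatch (idx f : bor -> K) :
  discrete_rv idx -> discrete_rv f -> discrete_rv (mismatch idx f).
Proof.
move=> mi mf.
rewrite (_ : mismatch idx f = (fun u : K * K =>
  if u.1 == u.2 then None else Some u.1) \o (fun x => (idx x, f x)))//.
by apply: discrete_rv_comp; exact: discrete_rv_pair.
Qed.

(** [gibbs_weight] with weight 0 on [None] and [L] elsewhere. The mean weight is [L] times the
    probability of an error, which is taken below [e / (2 * L)]. The other term is at most the
    number of cells times [expR (- L)], hence at most that number divided by [L], which is
    [e / 2]. *)
Lemma mismatch_small_entropy (idx : bor -> K) (e : R) :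
  discrete_rv idx -> (forall a, idx @^-1` [set a] = val a) -> 0 < e ->
  exists k (f : bor -> K), (forall x y : Sigma, agree k x y -> f x = f y) /\
    ent (law rho (mismatch idx f)) <= e.
Proof.
move=> midx idxP e0.
have K0 : (0 < #|{: K}|)%N by apply/card_gt0P; exists (idx point).
have K0' : 0 < #|{: K}|%:R :> R by rewrite ltr0n.
pose L : R := 2 * #|{: K}|%:R / e.
have L0 : 0 < L by rewrite divr_gt0// mulr_gt0.
have d0 : 0 < e / (2 * L) by rewrite divr_gt0// mulr_gt0.
have [k [f [fk hf]]] := partition_local_approx midx idxP d0.
exists k, f; split => //.
have mf : discrete_rv f by exact: discrete_rv_local fk.
have mm := discrete_rv_mismatch midx mf.
pose w (o : option K) : R := if o is Some _ then L else 0.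
apply: le_trans (gibbs_weight w (law_pmf rho mm)) _.
have -> : \sum_o law rho (mismatch idx f) o * w o =
    fine (rho [set x | idx x != f x]) * L.
  transitivity ((\sum_(o : option K | o != None) law rho (mismatch idx f) o) * L).
    rewrite mulr_suml [RHS]big_mkcond; apply: eq_bigr => -[a|] _ //=.
    by rewrite mulr0.
  congr (_ * L).
  have := probability_preimage rho (fun o : option K => o != None) mm.
  rewrite [X in rho X](_ : _ = [set x | idx x != f x]); first by move=> ->.
  by apply/seteqP; split=> x /=; rewrite /mismatch; case: (idx x == f x).
have h1 : fine (rho [set x | idx x != f x]) * L <= e / 2.
  have : fine (rho [set x | idx x != f x]) <= e / (2 * L).
    rewrite -lee_fin fineK//; apply: fin_num_measure.
    rewrite (_ : [set x | _] = (fun x => (idx x, f x)) @^-1` [set u | u.1 != u.2])//.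
    by apply: discrete_rv_preimage; exact: discrete_rv_pair.
  move=> /(ler_wpM2r (ltW L0))/le_trans; apply.
  by rewrite le_eqVlt; apply/orP; left; apply/eqP; field; rewrite !gt_eqF.
have h2 : ln (\sum_o expR (- w o)) <= e / 2.
  have -> : \sum_o expR (- w o) = 1 + #|{: K}|%:R * expR (- L).
    rewrite (bigD1 None)//= oppr0 expR0; congr (_ + _).
    transitivity (\sum_(a : K) expR (- L)); last by rewrite sumr_const mulr_natl.
    rewrite (reindex_omap Some id)//=; last by case.
    by apply: eq_bigl => a; rewrite eqxx.
  have E0 := expR_gt0 (- L).
  have hp : 0 < #|{: K}|%:R * expR (- L) by rewrite mulr_gt0.
  apply: le_trans (@le_ln1Dx _ _ _) _; first lra.
  rewrite expRN.
  have hL : (expR L)^-1 <= L^-1.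
    rewrite lef_pV2 ?posrE ?expR_gt0//.
    by have := expR_ge1Dx L; lra.
  apply: le_trans (ler_wpM2l (ltW K0') hL) _.
  rewrite /L le_eqVlt; apply/orP; left; apply/eqP; field.
  by rewrite !gt_eqF.
by apply: le_trans (lerD h1 h2) _; rewrite -splitr.
Qed.

(* A cell of the partition is recovered from a local approximation, which the
   windows at the corners determine, and from the mismatch. *)
Lemma entropy_wrt_le M : (0 < M)%N ->
  entropy_wrt rho P <= ent (law rho (window M)) / M%:R.
Proof.
move=> M0; have M0' : 0 < M%:R :> R by rewrite ltr0n.
have [idx [midx idxP]] := partition_index.
set H := ent _; have H0 : 0 <= H by exact: ent_window_ge0.
apply: limn_le; first by rewrite divr_ge0.
move=> e e0; have e2 : 0 < e / 2 by rewrite divr_gt0.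
have [k [f [fk hf]]] := mismatch_small_entropy midx idxP e2.
have mf : discrete_rv f by exact: discrete_rv_local fk.
have mm := discrete_rv_mismatch midx mf.
near=> n.
rewrite (partition_entropy_join n midx idxP).
have n0 : (0 < n)%N by near: n; exists 1%N.
have bn0 : 0 < #|` fbox c d n|%:R :> R.
  by rewrite ltr0n; case: (n) n0 => // m _; exact: card_fbox_gt0.
rewrite -/(fbox c d n) ler_pdivrMr//.
(* The corners serve the box of radius [n + k], because at a site of the box of radius [n] the guess
   [f] looks [k] further. *)
pose Y (i : corners c hd M (n + k) + fbox c d n) (x : bor) :
    {ffun 'I_M -> F} + option K :=
  match i with
  | inl h => inl (window M ((@shift R c d F hF (val h) : bor -> bor) x))
  | inr g => inr (mismatch idx f ((@shift R c d F hF (val g) : bor -> bor) x))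
  end.
have mYl (h : corners c hd M (n + k)) : discrete_rv (window M \o (@shift R c d F hF (val h) : bor -> bor)).
  by apply: discrete_rv_shift; exact: discrete_rv_window.
have mYr (g : fbox c d n) : discrete_rv (mismatch idx f \o (@shift R c d F hF (val g) : bor -> bor)).
  exact: discrete_rv_shift.
have mY i : discrete_rv (Y i).
  by case: i => i; [exact: (discrete_rv_comp inl (mYl i))|exact: (discrete_rv_comp inr (mYr i))].
apply: le_trans (ent_le_sum rho mY _) _.
  move=> x y xy; apply/ffunP => g; rewrite !ffunE.
  have fxy : f (@shift R c d F hF (val g) x) = f (@shift R c d F hF (val g) y).
    apply: fk => g' g'k; rewrite /shift.
    have : val g + g' \in fbox c d (n + k).
      rewrite in_fbox (leq_ltn_trans (supnormD _ _))//.
      have := valP g; rewrite in_fbox => gn.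
      by rewrite -addSn leq_add// ltnW.
    move=> /(corners_cover hd M0)[h hc [r rM ->]].
    have [] := xy (inl [` hc]%fset).
    by move=> /ffunP/(_ (Ordinal rM)); rewrite !ffunE.
  have [] := xy (inr g); rewrite /mismatch fxy.
  by case: eqP => [->|_]; case: eqP => [->|_] // [].
rewrite big_sumType /=.
have hl h : ent (law rho (Y (inl h))) <= H.
  apply: le_trans (ent_law_comp_le inl (mYl h)) _.
  by rewrite law_shift//; exact: discrete_rv_window.
have hr g : ent (law rho (Y (inr g))) <= e / 2.
  apply: le_trans (ent_law_comp_le inr (mYr g)) _.
  by rewrite law_shift.
apply: le_trans (lerD (ler_sum _ (fun h _ => hl h)) (ler_sum _ (fun g _ => hr g))) _.
rewrite !sumr_const -!cardfE -[H *+ _]mulr_natl -[(e / 2) *+ _]mulr_natl.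
have hc : #|` corners c hd M (n + k)|%:R * H <= (H / M%:R + e / 2) * #|` fbox c d n|%:R.
  by near: n; exact: corners_density.
apply: le_trans (lerD hc (lexx _)) _.
rewrite [X in _ + X]mulrC -mulrDl ler_wpM2r ?ler0n//; lra.
Unshelve. all: by end_near.
Qed.

End Partition.
Lemma entropy_le_window M : (0 < M)%N ->
  (entropy rho <= (ent (law rho (window M)) / M%:R)%:E)%E.
Proof.
move=> M0; apply: ge_ereal_sup => _ [P finP <-].
by rewrite lee_fin; exact: entropy_wrt_le.
Qed.

End Invariant.
End Windows.

(** * Independent uniform letters from digits *)

Section Digits.
Context (R : realType).

(** The source of randomness: the digits in base [N] of a uniform point are independent and
    uniform. *)
Definition unit_interval_prob : probability (measurableTypeR R) R :=
  mnormalize (mrestr (@lebesgue_measure R) (measurable_itv `[0, 1[)) point.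

Lemma unit_interval_probE (A : set (measurableTypeR R)) :
  unit_interval_prob A = lebesgue_measure (A `&` `[0, 1[).
Proof.
have mT : mrestr (@lebesgue_measure R) (measurable_itv `[0, 1[) setT = 1%E.
  rewrite /mrestr setTI lebesgue_measure_itv /= lte_fin ltr01.
  by rewrite oppr0 adde0.
rewrite /unit_interval_prob /= /mnormalize /= [X in X == _]mT.
rewrite [X in _ || (X == _)]mT [X in fine X]mT onee_eq0 /= /mrestr.
by rewrite invr1 mule1.
Qed.

Context (F : finType) (z : F).
Let N := #|F|.
Hypothesis N2 : (1 < N)%N.

Definition floor_pow (k : nat) (u : R) : nat := Num.trunc (u * (N ^ k)%:R).

Definition digit (k : nat) (u : R) : nat := (floor_pow k.+1 u %% N)%N.

Definition digit_letter (k : nat) (u : measurableTypeR R) : F :=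
  nth z (enum F) (digit k u).

Lemma pow_gt0 k : 0 < (N ^ k)%:R :> R.
Proof. by rewrite ltr0n expn_gt0 ltnW. Qed.

Lemma floor_powS k u : 0 <= u ->
  floor_pow k.+1 u = (floor_pow k u * N + digit k u)%N.
Proof.
move=> u0; rewrite /digit [LHS](divn_eq _ N); congr (_ * _ + _)%N.
have /truncn_itv := mulr_ge0 u0 (ltW (pow_gt0 k.+1)).
have /truncn_itv := mulr_ge0 u0 (ltW (pow_gt0 k)).
rewrite -/(floor_pow k u) -/(floor_pow k.+1 u) expnS natrM mulrCA.
have N0 : 0 < N%:R :> R by rewrite ltr0n ltnW.
move: (floor_pow k u) (floor_pow k.+1 u) => a b /andP[a1 a2] /andP[b1 b2].
apply/eqP; rewrite eqn_leq; apply/andP; split.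
  rewrite -ltnS ltn_divLR ?(ltnW N2)// -(ltr_nat R) natrM.
  by apply: le_lt_trans b1 _; rewrite mulrC ltr_pM2r.
rewrite leq_divRL ?(ltnW N2)// -ltnS -(ltr_nat R) natrM.
by apply: le_lt_trans b2; rewrite mulrC ler_pM2l.
Qed.

Fixpoint digit_value (w : nat -> nat) (k : nat) : nat :=
  if k is k'.+1 then (digit_value w k' * N + w k')%N else 0%N.

Lemma digit_value_lt w k : (forall i, (i < k)%N -> (w i < N)%N) ->
  (digit_value w k < N ^ k)%N.
Proof.
elim: k => [//|k ih] hw /=.
have h1 := ih (fun i ik => hw i (leqW ik)); have h2 := hw k (leqnn _).
rewrite expnS; apply: (@leq_trans ((digit_value w k).+1 * N)%N).
  by rewrite mulSn [(N + _)%N]addnC ltn_add2l.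
by rewrite mulnC leq_mul2l h1 orbT.
Qed.

(** Turns a prescription of the first [k] digits into membership in one interval of length [N ^- k],
    whose Lebesgue measure is known. *)
Lemma digit_valueP w k u : 0 <= u < 1 -> (forall i, (i < k)%N -> (w i < N)%N) ->
  (forall i, (i < k)%N -> digit i u = w i) <-> floor_pow k u = digit_value w k.
Proof.
move=> /andP[u0 u1]; elim: k => [|k ih] hw /=.
  split=> // _; rewrite /floor_pow expn0 mulr1.
  by apply/eqP; rewrite truncn_eq// u0.
rewrite floor_powS//; have {}ih := ih (fun i ik => hw i (leqW ik)).
have dN : (digit k u < N)%N by rewrite ltn_pmod ?(ltnW N2).
have wN := hw k (leqnn _).
split=> [h|h].
  by rewrite (h k)// ih.1// => i ik; rewrite h// leqW.
have e1 : floor_pow k u = digit_value w k.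
  have := congr1 (divn^~ N) h.
  by rewrite !divnMDl ?(ltnW N2)// !divn_small// !addn0.
have e2 : digit k u = w k by move: h; rewrite e1 => /addnI.
move=> i; rewrite ltnS leq_eqVlt => /predU1P[->//|]; exact: ih.2.
Qed.

Lemma discrete_digit_letter k : discrete_rv (digit_letter k).
Proof.
move=> a.
rewrite [X in measurable X](_ : _ = \bigcup_(j in [set j | nth z (enum F) (j %% N) = a])
    [set u : measurableTypeR R | floor_pow k.+1 u = j]); last first.
  by apply/seteqP; split=> [u /= <-|u [j /= <- <-]]; [exists (floor_pow k.+1 u)|].
apply: bigcup_measurable => j _; have K0 := pow_gt0 k.+1.
(* [Num.trunc] sends negative reals to 0, so the level set of 0 is a half-line and is treated
   apart. *)
case: j => [|j].
  rewrite [X in measurable X](_ : _ = `]-oo, (N ^ k.+1)%:R^-1[%classic); first exact: measurable_itv.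
  apply/seteqP; split=> u /=; rewrite in_itv /= /floor_pow.
    move=> /eqP; rewrite -leqn0 leqNgt truncn_gt0 -ltNge.
    by rewrite -ltr_pdivlMr// div1r.
  rewrite -[X in _ < X]div1r ltr_pdivlMr// => h.
  by apply/eqP; rewrite -leqn0 leqNgt truncn_gt0 -ltNge.
rewrite [X in measurable X](_ : _ = `[j.+1%:R / (N ^ k.+1)%:R, j.+2%:R / (N ^ k.+1)%:R[%classic); first exact: measurable_itv.
apply/seteqP; split=> u /=; rewrite in_itv /= /floor_pow ler_pdivrMr// ltr_pdivlMr//.
  move=> h.
  have u0 : 0 <= u * (N ^ k.+1)%:R.
    by move: h; rewrite truncn_floor; case: ifP.
  by rewrite -truncn_eq// h.
move=> /andP[h1 h2]; apply/eqP; rewrite truncn_eq ?h1//.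
exact: le_trans h1.
Qed.

Definition digit_letters k (u : measurableTypeR R) : {ffun 'I_k -> F} :=
  [ffun i => digit_letter (val i) u].

Lemma discrete_digit_letters k : discrete_rv (@digit_letters k).
Proof. by apply: discrete_rv_finfun => i; exact: discrete_digit_letter. Qed.

Lemma law_digit_letters k w :
  law unit_interval_prob (@digit_letters k) w = (N ^ k)%:R^-1.
Proof.
pose w' i := if insub i is Some i' then index (w i') (enum F) else 0%N.
have w'N i : (i < k)%N -> (w' i < N)%N.
  by move=> ik; rewrite /w' insubT /N cardE index_mem mem_enum.
have K0 := pow_gt0 k.
rewrite /law unit_interval_probE.
set j := digit_value w' k.
have jN : (j < N ^ k)%N by exact: digit_value_lt.
rewrite (_ : _ `&` _ = `[j%:R / (N ^ k)%:R, j.+1%:R / (N ^ k)%:R[%classic).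
  rewrite lebesgue_measure_itv /= lte_fin ltr_pM2r ?invr_gt0// ltr_nat ltnSn /=.
  by rewrite -mulrBl -natrB ?leqnSn// subSnn mul1r.
have wP (u : R) : 0 <= u < 1 -> @digit_letters k u = w <-> floor_pow k u = j.
  move=> u01; rewrite -digit_valueP//; split=> [/ffunP h i ik|h].
    have := h (Ordinal ik); rewrite ffunE /digit_letter /= => hi.
    rewrite /w' insubT -hi index_uniq ?enum_uniq//.
    by rewrite -cardE ltn_pmod// ltnW.
  apply/ffunP => i; rewrite ffunE /digit_letter h ?ltn_ord//.
  by rewrite /w' valK nth_index// mem_enum.
apply/seteqP; split=> [u /= [uw]|u /=]; rewrite !in_itv /= ler_pdivrMr// ltr_pdivlMr//.
  move=> u01; have h := (wP _ u01).1 uw.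
  by rewrite -truncn_eq ?mulr_ge0 ?(ltW K0)//; [exact/eqP|case/andP: u01].
move=> /andP[h1 h2].
have u0 : 0 <= u by rewrite -(pmulr_lge0 _ K0); exact: le_trans h1.
have u1 : u < 1.
  rewrite -(ltr_pM2r K0) mul1r; apply: lt_le_trans h2 _.
  by rewrite ler_nat.
split; last by rewrite u0.
apply: (wP _ _).2; first by rewrite u0.
by apply/eqP; rewrite truncn_eq ?h1// mulr_ge0// ltW.
Qed.

(** The first [k] digits are uniform among words, and the number of words satisfying the constraints
    factorizes over positions. After division by [N ^ k], a prescribed position contributes [1 / N]
    and a free one contributes 1. *)
Lemma digit_letters_independent (I : finType) (e : I -> nat) (v : I -> F) :
  injective e ->
  unit_interval_prob [set u | forall i, digit_letter (e i) u = v i] =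
  ((N%:R^-1) ^+ #|I|)%:E.
Proof.
move=> einj; pose k := (\max_i e i).+1.
have ek i : (e i < k)%N by rewrite ltnS leq_bigmax.
pose e' i := Ordinal (ek i).
have e'inj : injective e' by move=> i i' [/einj].
pose B (w : {ffun 'I_k -> F}) := [forall i, w (e' i) == v i].
have := probability_preimage unit_interval_prob B (@discrete_digit_letters k).
rewrite [X in unit_interval_prob X](_ : _ = [set u | forall i, digit_letter (e i) u = v i]); last first.
  apply/seteqP; split=> u /=.
    by move=> /forallP h i; have := h i; rewrite ffunE => /eqP.
  by move=> h; apply/forallP => i; rewrite ffunE /= h.
move=> ->; congr EFin.
under eq_bigr do rewrite law_digit_letters.
pose chk j a := [forall i, (e' i == j) ==> (a == v i)].
have N0 : N%:R != 0 :> R by rewrite pnatr_eq0 -lt0n ltnW.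
transitivity (\sum_(w : {ffun 'I_k -> F}) \prod_j (N%:R^-1 * (chk j (w j))%:R : R)).
  rewrite big_mkcond; apply: eq_bigr => w _; rewrite big_split /= prodr_const card_ord.
  rewrite natrX exprVn; case: ifP => [/forallP Bw|/negbT].
    rewrite big1 ?mulr1// => j _; rewrite (_ : chk _ _ = true)//.
    by apply/forallP => i; apply/implyP => /eqP <-.
  rewrite negb_forall => /existsP[i wi].
  rewrite (bigD1 (e' i))//= (_ : chk _ _ = false) ?mul0r ?mulr0//.
  by apply/negbTE; rewrite negb_forall; apply/existsP; exists i; rewrite eqxx.
rewrite -(bigA_distr_bigA (fun j a => N%:R^-1 * (chk j a)%:R)) /=.
transitivity (\prod_j (if j \in codom e' then N%:R^-1 else 1 : R)); last first.
  rewrite -big_mkcond prodr_const; congr (_ ^+ _).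
  by rewrite card_codom.
apply: eq_bigr => j _; rewrite -mulr_sumr -natr_sum.
case: ifPn => [/codomP[i ->]|ji].
  rewrite (bigD1 (v i))//= big1 ?addn0.
    rewrite (_ : chk _ _ = true) ?mulr1//.
    by apply/forallP => i'; apply/implyP => /eqP/e'inj ->.
  move=> a avi; rewrite (_ : chk _ _ = false)//.
  by apply/negbTE; rewrite negb_forall; apply/existsP; exists i; rewrite eqxx.
rewrite (eq_bigr (fun=> 1%N)) ?sum1_card ?mulVf// => a _.
rewrite (_ : chk _ _ = true)//; apply/forallP => i; apply/implyP => /eqP ij.
by move: ji; rewrite -ij codom_f.
Qed.

End Digits.

(** * Masked independent letters *)

Section MaskedMeasures.
Context (R : realType) (c : coordinates) (d : nat) (hd : (1 <= d)%N).
Context (F : finType) (hF : (1 < #|F|)%N).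
Local Notation G := (lattice c d).
Local Notation Sigma := (config R c d hF).
Local Notation bor := (borel R c d hF).
Local Notation I01 := (measurableTypeR R).
Local Notation N := #|F|.

(** Assigns each site a digit of its own; passing through integer vectors treats both lattices at
    once. *)
Definition lattice_code (g : G) : nat :=
  choice.pickle ([ffun i => coord_int (g i)] : {ffun 'I_d -> int}).

Lemma lattice_code_inj : injective lattice_code.
Proof.
move=> g h /(pcan_inj (@choice.pickleK _)) /ffunP gh; apply/ffunP => i.
by have := gh i; rewrite !ffunE => /coord_int_inj.
Qed.

Lemma measurable_config (f : I01 -> bor) : (forall g : G, discrete_rv (fun u => f u g)) ->
  measurable_fun [set: I01] f.
Proof.
move=> mf.
apply: (@measurability _ _ I01 bor setT f (@open Sigma)) => //.
move=> _ [B oB <-]; rewrite setTI (open_bigcup_local oB) preimage_bigcup.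
apply: bigcup_measurable => n _.
set L := [set x | _]; have lL : local_set n L by exact: local_set_interior.
pose X (u : I01) := [ffun g : fbox c d n => f u (val g)].
rewrite [X in measurable X](_ : _ = X @^-1` [set w | exists2 x, L x & pattern (fbox c d n) x = w]).
  by apply: discrete_rv_preimage; apply: discrete_rv_finfun => g; exact: mf.
apply/seteqP; split=> u /=.
  by move=> Lu; exists (f u) => //; apply/ffunP => g; rewrite !ffunE.
move=> [x Lx /ffunP xu]; apply: lL Lx => g gn.
have gb : g \in fbox c d n by rewrite in_fbox.
by have := xu [` gb]%fset; rewrite !ffunE.
Qed.

Section Mask.
Variables (z : F) (p : nat).

Definition mask (q : int) (u : I01) : bor :=
  fun g => if (p %| height hd g - q)%Z then digit_letter z (lattice_code g) u
           else z.

Lemma measurable_mask q : measurable_fun [set: I01] (mask q).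
Proof.
apply: measurable_config => g; rewrite /mask; case: (p %| height hd g - q)%Z.
  exact: discrete_digit_letter.
move=> a; have [->|za] := eqVneq a z.
  by rewrite [X in measurable X](_ : _ = setT)//; apply/seteqP.
rewrite [X in measurable X](_ : _ = set0)//; apply/seteqP; split=> // u /= za'.
by rewrite za' eqxx in za.
Qed.

HB.instance Definition _ (q : int) :=
  isMeasurableFun.Build _ _ _ _ (mask q) (measurable_mask q).

(** A single offset is not shift invariant, hence the sum over offsets; its mass is [p], by which
    [mnormalize] divides, as [mask_probE] makes explicit. *)
Definition mask_prob : probability bor R :=
  mnormalize (msum (fun q : nat => distribution (unit_interval_prob R) (mask q)) p) point.

Hypothesis p0 : (0 < p)%N.

Lemma mask_probE (A : set bor) : measurable A ->
  fine (mask_prob A) =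
  (\sum_(q < p) fine (unit_interval_prob R (mask q @^-1` A))) / p%:R.
Proof.
move=> mA.
have mE (q : nat) B : measurable B ->
    distribution (unit_interval_prob R) (mask q) B =
    (fine (unit_interval_prob R (mask q @^-1` B)))%:E.
  move=> mB; rewrite fineK// fin_num_measure//.
  by rewrite -[X in measurable X]setTI; exact: measurable_mask.
have mS B : measurable B ->
  msum (fun q : nat => distribution (unit_interval_prob R) (mask q)) p B =
  (\sum_(q < p) fine (unit_interval_prob R (mask q @^-1` B)))%:E.
  by move=> mB; rewrite /msum -sumEFin; apply: eq_bigr => q _; exact: mE.
have mT : msum (fun q : nat => distribution (unit_interval_prob R) (mask q)) p setT = p%:R%:E.
  rewrite mS//; congr EFin.
  under eq_bigr do rewrite preimage_setT probability_setT /=.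
  by rewrite sumr_const card_ord.
rewrite /mask_prob /= /mnormalize /=; case: ifPn => [|_].
  have := mT; rewrite /msum /= => -> /=; rewrite eqe pnatr_eq0 gtn_eqF//.
have := mT; have := mS _ mA; rewrite /msum /= => -> -> /=.
by [].
Qed.

Definition residue_count (I : finType) (gam : I -> G) (q : int) : nat :=
  #|[pred i | (p %| height hd (gam i) - q)%Z]|.

Lemma mask_event (I : finType) (gam : I -> G) (w : I -> F) q : injective gam ->
  unit_interval_prob R [set u | forall i, mask q u (gam i) = w i] =
  (if [forall i, (p %| height hd (gam i) - q)%Z || (w i == z)]
   then N%:R^-1 ^+ residue_count gam q else 0)%:E.
Proof.
move=> gaminj; case: ifPn => [/forallP h|]; last first.
  rewrite negb_forall => /existsP[i]; rewrite negb_or => /andP[pi wi].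
  rewrite (_ : [set u | _] = set0) ?measure0//.
  apply/seteqP; split=> // u /= /(_ i); rewrite /mask (negbTE pi) => wz.
  by rewrite wz eqxx in wi.
pose J := {i : I | (p %| height hd (gam i) - q)%Z}.
have -> : residue_count gam q = #|{: J}| by rewrite card_sig.
have cinj : injective (fun j : J => lattice_code (gam (val j))).
  by move=> j j' /lattice_code_inj/gaminj/val_inj.
rewrite -(@digit_letters_independent R F z hF _ _ (fun j : J => w (val j)) cinj).
congr (unit_interval_prob R _); apply/seteqP; split=> u /= hu.
  by move=> [i pi] /=; have := hu i; rewrite /mask pi.
move=> i; rewrite /mask; case: ifP => pi.
  exact: (hu (exist _ i pi)).
by have := h i; rewrite pi /= => /eqP.
Qed.

Definition frozen_pattern (I : finType) (gam : I -> G) (q : int) (w : {ffun I -> F}) :=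
  [forall i, (p %| height hd (gam i) - q)%Z || (w i == z)].

Lemma law_mask (I : finType) (gam : I -> G) q (w : {ffun I -> F}) : injective gam ->
  law (unit_interval_prob R) (fun u => [ffun i => mask q u (gam i)]) w =
  if frozen_pattern gam q w then N%:R^-1 ^+ residue_count gam q else 0.
Proof.
move=> gaminj; rewrite /law.
rewrite (_ : _ @^-1` _ = [set u | forall i, mask q u (gam i) = w i]).
  by rewrite mask_event.
apply/seteqP; split=> u /=.
  by move=> <- i; rewrite ffunE.
by move=> h; apply/ffunP => i; rewrite ffunE.
Qed.

Lemma discrete_mask (I : finType) (gam : I -> G) q :
  discrete_rv (fun u => [ffun i => mask q u (gam i)]).
Proof.
apply: discrete_rv_finfun => i a.
have := discrete_rv_coordinate (gam i) a => mA.
rewrite -[X in measurable X]setTI. exact: (measurable_mask q measurableT (mA R hF)).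
Qed.

(** This is an equality of laws, not of configurations, since the shift makes a site read another
    digit. By [law_mask], the probability of a pattern depends only on which sites are free, that
    is, on heights relative to the offset. *)
Lemma mask_shift q h (A : set bor) n : @local_set R c d F hF n A ->
  unit_interval_prob R (mask q @^-1` (@shift R c d F hF h @^-1` A)) =
  unit_interval_prob R (mask (q - height hd h) @^-1` A).
Proof.
move=> lA; pose S := fbox c d n.
pose pA : pred {ffun S -> F} := fun w => `[< exists2 x, A x & pattern S x = w >].
have AE (x : Sigma) : A x <-> pA (pattern S x).
  split=> [Ax|/asboolP[y Ay /ffunP yx]]; first by apply/asboolP; exists x.
  apply: lA Ay => g gn; have gS : g \in S by rewrite in_fbox.
  by have := yx [` gS]%fset; rewrite !ffunE.
pose X1 u := [ffun g : S => mask q u (h + val g)].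
pose X2 u := [ffun g : S => mask (q - height hd h) u (val g)].
have gi : injective (fun g : S => h + val g) by move=> g g' /lattice_addI/val_inj.
transitivity (unit_interval_prob R (X1 @^-1` [set w | pA w])).
  congr (unit_interval_prob R _); apply/seteqP; split=> u /=;
  rewrite AE (_ : pattern S _ = X1 u)//; apply/ffunP => g; by rewrite !ffunE.
transitivity (unit_interval_prob R (X2 @^-1` [set w | pA w])); last first.
  congr (unit_interval_prob R _); apply/seteqP; split=> u /=;
  rewrite AE (_ : pattern S _ = X2 u)//; apply/ffunP => g; by rewrite !ffunE.
rewrite !probability_preimage; [|exact: discrete_mask|exact: discrete_mask].
congr EFin; apply: eq_bigr => w _; rewrite !law_mask//.
have E (g : S) : (p %| height hd (h + val g) - q)%Z = (p %| height hd (val g) - (q - height hd h))%Z.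
  by rewrite heightD; congr (_ %| _)%Z; ring.
rewrite /frozen_pattern /residue_count; congr (if _ then _ ^+ _ else _).
  by apply: eq_forallb => g; rewrite E.
by apply: eq_card => g; rewrite !inE E.
Qed.

Lemma mask_mod q q' : (p %| q - q')%Z -> mask q = mask q'.
Proof.
move=> qq; apply/funext => u; apply/funext => g; rewrite /mask.
rewrite (_ : height hd g - q' = (height hd g - q) + (q - q')); last by ring.
by have -> : (p %| (height hd g - q) + (q - q'))%Z = (p %| height hd g - q)%Z by exact: rpredDr.
Qed.

Lemma shift_invariant_mask_prob : shift_invariant mask_prob.
Proof.
move=> h A mA.
pose sh := (@shift R c d F hF h : bor -> bor).
have msh : measurable_fun setT sh by move=> _ B mB; rewrite setTI; exact: measurable_shift.
suff H n B : @local_set R c d F hF n B -> mask_prob (sh @^-1` B) = mask_prob B.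
  pose sh' : {mfun bor >-> bor} := mfun_Sub (mem_set msh).
  exact: (@local_measure_unique R c d F hF (distribution mask_prob sh') mask_prob H).
move=> lB; have mB := measurable_local lB; have mB' := measurable_shift h mB.
rewrite -[LHS]fineK ?fin_num_measure// -[RHS]fineK ?fin_num_measure//.
congr EFin; rewrite !mask_probE//; congr (_ / _).
under eq_bigr do rewrite (mask_shift _ _ lB).
(* The shift by [h] permutes the offsets modulo [p]; [t] is this permutation. *)
have tP (q : 'I_p) : (`|((q%:Z - height hd h) %% p)%Z| < p)%N.
  have m0 : (0 <= (q%:Z - height hd h) %% p)%Z by apply: modz_ge0; lia.
  lia.
pose t q := Ordinal (tP q).
have tE (q : 'I_p) : (p %| (q%:Z - height hd h) - (t q)%:Z)%Z.
  have m0 : (0 <= (q%:Z - height hd h) %% p)%Z by apply: modz_ge0; lia.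
  rewrite /t /= gez0_abs//; apply/dvdzP; exists ((q%:Z - height hd h) %/ p)%Z.
  by rewrite {1}(divz_eq (q%:Z - height hd h) p) addrK.
have tinj : injective t.
  move=> q q' tq.
  have : (p %| (q%:Z - height hd h - (t q)%:Z) - (q'%:Z - height hd h - (t q')%:Z))%Z.
    exact: rpredB.
  rewrite tq (_ : _ - _ - (_ - _) = q%:Z - q'%:Z); last by ring.
  have := (ltn_ord q, ltn_ord q') => -[h1 h2] /dvdzP[k hk]; apply/val_inj => /=.
  move: h1 h2 hk; move: (nat_of_ord q) (nat_of_ord q') => a b ap bp hk.
  have [k0|[k1|k1]] : k = 0 \/ (1 <= k) \/ (k <= -1) by lia.
  - by move: hk; rewrite k0 mul0r; lia.
  - have : p%:Z <= k * p%:Z by rewrite ler_peMl.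
    lia.
  have : k * p%:Z <= - p%:Z by rewrite -[- p%:Z]mulN1r ler_wpM2r.
  lia.
rewrite [RHS](reindex_inj tinj); apply: eq_bigr => q _.
by rewrite (mask_mod (tE q)).
Qed.

End Mask.
End MaskedMeasures.

(** * Counting admissible patterns *)

Section EntropyBounds.
Context (R : realType).

(** [gibbs_weight] where a word weighs the logarithm of the bound on its class. Each of the three
    classes then contributes at most 1 to the normalizing sum, whence [ln 3]. *)
Lemma ent_two_classes (W : finType) (p : W -> R) (A B : {set W}) (a b pA pB : R) :
  is_pmf p -> (forall w, w \in A -> w \notin B) -> #|A|%:R <= a -> #|B|%:R <= b -> 0 < a -> 0 < b ->
  pA = \sum_(w in A) p w -> pB = \sum_(w in B) p w ->
  ent p <= ln 3 + pA * ln a + pB * ln b + (1 - pA - pB) * ln #|W|%:R.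
Proof.
move=> pp dAB Aa Bb a0 b0 pAE pBE.
pose c w := if w \in A then ln a else if w \in B then ln b else ln (#|W|%:R : R).
apply: le_trans (gibbs_weight c pp) _.
have dAB' w : w \in A -> w \in B = false by move=> /dAB/negbTE.
have W0 : 0 < #|W|%:R :> R.
  rewrite ltr0n lt0n; apply/eqP => W0; have := pp.2; rewrite big1 => [/esym/eqP|w _].
    by rewrite oner_eq0.
  by have := card0_eq W0 w.
pose C := [set w | (w \notin A) && (w \notin B)]%SET.
have split3 (f : W -> R) : \sum_w f w =
    \sum_(w in A) f w + \sum_(w in B) f w + \sum_(w in C) f w.
  rewrite !(big_mkcond (fun w => w \in _)) -!big_split; apply: eq_bigr => w _ /=.
  rewrite !inE; have := dAB' w; case: (w \in A) => [->//|_] /=; last first.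
    by case: (w \in B); rewrite /= ?add0r ?addr0.
  by rewrite !addr0.
have pC : \sum_(w in C) p w = 1 - pA - pB.
  by have := split3 p; rewrite pp.2 -pAE -pBE => ->; ring.
have cA w : w \in A -> c w = ln a by rewrite /c => ->.
have cB w : w \in B -> c w = ln b.
  by rewrite /c => wB; rewrite wB; case: ifP => // wA; rewrite dAB' in wB.
have cC w : w \in C -> c w = ln #|W|%:R.
  by rewrite /c !inE => /andP[/negbTE -> /negbTE ->].
have h1 : \sum_w p w * c w = pA * ln a + pB * ln b + (1 - pA - pB) * ln #|W|%:R.
  rewrite split3 -pC pAE pBE !mulr_suml; congr (_ + _ + _); apply: eq_bigr => w wX;
    [by rewrite cA|by rewrite cB|by rewrite cC].
have cst (X : {set W}) (x : R) : 0 < x -> (forall w, w \in X -> c w = ln x) ->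
    #|X|%:R <= x -> \sum_(w in X) expR (- c w) <= 1.
  move=> x0 cX Xx; rewrite (eq_bigr (fun=> x^-1)).
    by rewrite sumr_const -mulr_natl ler_pdivrMr// mul1r.
  by move=> w wX; rewrite cX// expRN lnK.
have h2 : ln (\sum_w expR (- c w)) <= ln 3.
  rewrite ler_ln ?posrE//.
    rewrite split3 (_ : 3 = 1 + 1 + 1); last by ring.
    rewrite !lerD//; [exact: cst cA _|exact: cst cB _|].
    by apply: cst cC _ => //; rewrite ler_nat max_card.
  have [w _] : exists w : W, True.
    by move: W0; rewrite ltr0n => /card_gt0P[w _]; exists w.
  rewrite (bigD1 w)//=; apply: ltr_pwDl; first exact: expR_gt0.
  by apply: sumr_ge0 => ? _; exact: expR_ge0.
rewrite h1; lra.
Qed.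

Lemma ent_ge_of_le (W : finType) (p : W -> R) (L : R) : is_pmf p ->
  (forall w, p w <= expR (- L)) -> L <= ent p.
Proof.
move=> pp hL; rewrite /ent -sumrN -[L]mul1r -pp.2 mulr_suml.
apply: ler_sum => w _; have [->|pw] := eqVneq (p w) 0; first by rewrite !mul0r oppr0.
have pw0 : 0 < p w by rewrite lt_neqAle eq_sym pw pp.1.
rewrite -mulrN ler_wpM2l ?pp.1// lerNr -ler_expR lnK ?posrE//.
Qed.

End EntropyBounds.

Section Admissible.
Context (F : finType).
Local Notation N := #|F|.

Definition admissible (z : F) (p M : nat) : {set {ffun 'I_M -> F}} :=
  [set w : {ffun 'I_M -> F} | [exists q : 'I_p, [forall k : 'I_M, (k %% p == q)%N || (w k == z)]]]%SET.

(** For each of the [p] residues, a word is determined by its [m] letters at the positions with that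
    residue. *)
Lemma card_admissible z p m : (0 < p)%N ->
  (#|admissible z p (m * p)| <= p * N ^ m)%N.
Proof.
move=> p0.
pose A (q : 'I_p) := [set w : {ffun 'I_(m * p) -> F} |
  [forall k : 'I_(m * p), (k %% p == q)%N || (w k == z)]]%SET.
have cA q : (#|A q| <= N ^ m)%N.
  have ub (j : 'I_m) : (j * p + q < m * p)%N.
    have := ltn_ord j; have := ltn_ord q; move: (nat_of_ord j) (nat_of_ord q).
    by move=> a b; nia.
  pose r (w : {ffun 'I_(m * p) -> F}) := [ffun j : 'I_m => w (Ordinal (ub j))].
  have rinj : {in A q &, injective r}.
    move=> w w'; rewrite !inE => /forallP h /forallP h' /ffunP rr.
    apply/ffunP => k; have := h k; have := h' k.
    case: eqP => [kq _ _|_ /= /eqP -> /eqP ->//].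
    have jm : (k %/ p < m)%N by rewrite ltn_divLR.
    have := rr (Ordinal jm); rewrite !ffunE.
    rewrite (_ : Ordinal (ub (Ordinal jm)) = k)//.
    by apply/val_inj => /=; rewrite -kq -divn_eq.
  rewrite -(card_in_imset rinj) (leq_trans (max_card _))// card_ffun.
  by rewrite card_ord.
have sub : admissible z p (m * p) \subset (\bigcup_(q : 'I_p) A q)%SET.
  apply/fintype.subsetP => w; rewrite inE => /existsP[q h].
  by apply/finset.bigcupP; exists q => //; rewrite inE.
apply: leq_trans (subset_leq_card sub) _.
apply: (@leq_trans (\sum_(q < p) N ^ m)%N); last by rewrite sum_nat_const card_ord.
elim/big_rec2: _ => [|q X k _ Xk]; first by rewrite cards0.
by rewrite (leq_trans (leq_card_setU _ _).1)// leq_add.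
Qed.

End Admissible.

(** * Entropy of the masked measures *)

Section MaskEntropy.
Context (R : realType) (c : coordinates) (d : nat) (hd : (1 <= d)%N).
Context (F : finType) (hF : (1 < #|F|)%N).
Local Notation G := (lattice c d).
Local Notation Sigma := (config R c d hF).
Local Notation bor := (borel R c d hF).
Local Notation N := #|F|.
Local Notation lnN := (ln (#|F|%:R : R)).
Variables (z : F) (p : nat).
Hypothesis p0 : (0 < p)%N.
Local Notation nu := (@mask_prob R c d hd F hF z p).
Local Notation msk := (@mask R c d hd F hF z p).
Local Notation win := (@window R c d hd F hF).
Local Notation pat := (@pattern R c d F hF).

Lemma lnN_gt0 : 0 < lnN.
Proof. by rewrite ln_gt0// ltr1n. Qed.

Lemma window_mask_admissible M (q : 'I_p) u :
  win M (msk q u) \in admissible z p M.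
Proof.
rewrite inE; apply/existsP; exists q; apply/forallP => k.
rewrite ffunE /mask height_axis; case: ifP => [|_]; last by rewrite eqxx orbT.
rewrite -eqz_mod_dvd !modz_nat => /eqP[->].
by rewrite modn_small ?eqxx.
Qed.

Lemma mask_prob_admissible M (A : {set {ffun 'I_M -> F}}) :
  admissible z p M \subset A ->
  fine (nu (win M @^-1` [set w | w \in A])) = 1.
Proof.
move=> /fintype.subsetP sA.
rewrite mask_probE//; last by apply: discrete_rv_preimage; exact: (@discrete_rv_window R c d hd F hF M).
rewrite (eq_bigr (fun=> 1)).
  by rewrite sumr_const card_ord divff// pnatr_eq0 -lt0n.
move=> q _; rewrite (_ : _ @^-1` _ = setT) ?probability_setT//.
by apply/seteqP; split=> // u _ /=; apply: sA; exact: window_mask_admissible.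
Qed.

Lemma ent_window_mask m : ent (law nu (win (m * p))) <=
  ln 3 + ln p%:R + m%:R * lnN.
Proof.
have mW := @discrete_rv_window R c d hd F hF (m * p).
have N0 : 0 < N%:R :> R by rewrite ltr0n ltnW.
(* The second class is empty, with bound 1; the admissible words carry all the mass, so the
   remainder vanishes. *)
have := @ent_two_classes R _ _ (admissible z p (m * p)) finset.set0
  (p * N ^ m)%:R 1 1 0 (law_pmf nu mW).
rewrite cards0 big_set0 ler01 ltr01 ler_nat card_admissible//.
rewrite -(probability_set_fin nu _ mW) mask_prob_admissible//.
rewrite ltr0n muln_gt0 p0 expn_gt0 (ltnW hF) /=.
have h0 w : w \in admissible z p (m * p) -> w \notin finset.set0 by move=> _; rewrite finset.in_set0.
move=> /(_ h0 isT isT isT isT erefl erefl); rewrite mul0r mul1r subrr subr0 mul0r !addr0.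
rewrite natrM lnM ?posrE ?ltr0n ?expn_gt0 ?(ltnW hF)// natrX lnXn// addrA.
by rewrite mulr_natl.
Qed.

Lemma residue_count_fbox n q : (#|` fbox c d n| <=
  p * residue_count hd p (fun g : fbox c d (n + p) => val g) q)%N.
Proof.
apply: leq_trans (card_residue_box c hd q n p0) _; rewrite leq_mul2l; apply/orP; right.
rewrite /residue_count cardE -(size_map val).
apply: uniq_leq_size; first exact: fset_uniq.
move=> g; rewrite in_residue_box -in_fbox => /andP[gb hg].
by apply/mapP; exists [` gb]%fset => //; rewrite mem_enum inE.
Qed.

(** Whatever the offset, the enlarged box has at least as many free sites as the small box has
    sites, divided by [p]. This caps the mass of every pattern, and [ent_ge_of_le] applies. *)
Lemma ent_pattern_mask_ge n :
  #|` fbox c d n|%:R / p%:R * lnN <= ent (law nu (pat (fbox c d (n + p)))).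
Proof.
have mP := @discrete_rv_pattern R c d F hF (fbox c d (n + p)).
have p0' : 0 < p%:R :> R by rewrite ltr0n.
have N0 : 0 < N%:R :> R by rewrite ltr0n ltnW.
apply: ent_ge_of_le; first exact: law_pmf.
move=> w; have mPw : measurable (pat (fbox c d (n + p)) @^-1` [set w]) by exact: mP.
rewrite /law (mask_probE _ _ p0 mPw).
set L := _ * lnN; rewrite ler_pdivrMr//.
apply: (@le_trans _ _ (\sum_(q < p) expR (- L))); last first.
  by rewrite sumr_const card_ord mulr_natr.
apply: ler_sum => q _.
have vi : injective (fun g : fbox c d (n + p) => val g) by exact: val_inj.
have := @law_mask R c d hd F hF z p _ _ q w vi; rewrite /law.
rewrite (_ : _ @^-1` [set w] = msk q @^-1` (pat (fbox c d (n + p)) @^-1` [set w])).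
  move=> ->; case: ifP => _; last exact: expR_ge0.
  rewrite -[X in X ^+ _]lnK ?posrE ?invr_gt0// -expRM_natl ler_expR lnV ?posrE//.
  rewrite mulrN lerN2 /L ler_wpM2r ?(ltW lnN_gt0)//.
  rewrite ler_pdivrMr// -natrM ler_nat mulnC.
  exact: residue_count_fbox.
by apply/seteqP; split=> u /= <-; apply/ffunP => g; rewrite !ffunE.
Qed.

(** [entropy_wrt] is a [limn], so lower bounds on its terms say nothing unless the sequence
    converges; hence the matching upper bound. It comes from windows of length [m * p], where
    [ln 3 + ln p] becomes negligible as [m] grows. *)
Lemma pattern_entropy_cvg :
  (fun n => ent (law nu (pat (fbox c d n))) / #|` fbox c d n|%:R) @ \oo -->
  lnN / p%:R.
Proof.
have p0' : 0 < p%:R :> R by rewrite ltr0n.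
have lp0 : 0 < lnN / p%:R by rewrite divr_gt0// lnN_gt0.
have inu := @shift_invariant_mask_prob R c d hd F hF z p p0.
have b0 n : (0 < n)%N -> 0 < #|` fbox c d n|%:R :> R.
  by rewrite ltr0n; case: n => // n _; exact: card_fbox_gt0.
apply/cvgrPdist_le => e e0.
have e2 : 0 < e / 2 by rewrite divr_gt0.
have [m m0 hm] : exists2 m, (0 < m)%N &
    ent (law nu (win (m * p))) / (m * p)%:R <= lnN / p%:R + e / 2.
  pose m := (Num.trunc ((ln 3 + ln p%:R) / p%:R / (e / 2))).+1.
  exists m => //; have m0 : 0 < m%:R :> R by rewrite ltr0n.
  have : (ln 3 + ln p%:R) / p%:R / (e / 2) < m%:R by exact: truncnS_gt.
  rewrite ltr_pdivrMr// => hm.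
  apply: le_trans (_ : (ln 3 + ln p%:R + m%:R * lnN) / (m * p)%:R <= _).
    by rewrite ler_wpM2r ?invr_ge0// ent_window_mask.
  rewrite mulrDl addrC lerD//.
    rewrite natrM le_eqVlt; apply/orP; left; apply/eqP; field.
    by rewrite !gt_eqF.
  rewrite natrM invfM [X in _ * X]mulrC mulrA ler_pdivrMr//.
  by rewrite [leRHS]mulrC ltW.
have mp0 : (0 < m * p)%N by rewrite muln_gt0 m0.
have H0 := @ent_window_ge0 R c d hd F hF nu (m * p).
(* With this choice [(lnN / p - e) * (1 + e')] is at most [lnN / p], which absorbs the growth from
   the box of radius [n] to that of radius [n + p]. *)
pose e' : R := e / (lnN / p%:R).
have e'0 : 0 < e' by rewrite divr_gt0.
have low : \forall n \near \oo,
    lnN / p%:R - e <= ent (law nu (pat (fbox c d n))) / #|` fbox c d n|%:R.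
  suff [K _ hK] : \forall n \near \oo, (0 < n)%N /\ lnN / p%:R - e <=
      ent (law nu (pat (fbox c d (n + p)))) / #|` fbox c d (n + p)|%:R.
    exists (K + p)%N => // n /= nK.
    have pn : (p <= n)%N by rewrite (leq_trans _ nK)// leq_addl.
    have := hK (n - p)%N; rewrite subnK//= => /(_ _)[]//.
    by rewrite leq_subRL// addnC.
  near=> n; have n0 : (0 < n)%N by near: n; exists 1%N.
  split => //; rewrite ler_pdivlMr ?b0 ?addn_gt0 ?n0//.
  apply: le_trans (ent_pattern_mask_ge n).
  have hb : #|` fbox c d (n + p)|%:R <= (1 + e') * #|` fbox c d n|%:R :> R.
    by near: n; exact: fbox_growth.
  have [le0|gt0] := leP (lnN / p%:R - e) 0.
    apply: (@le_trans _ _ 0); first by rewrite mulr_le0_ge0.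
    by rewrite mulr_ge0 ?(ltW lnN_gt0)// divr_ge0.
  apply: le_trans (ler_wpM2l (ltW gt0) hb) _.
  have -> : #|` fbox c d n|%:R / p%:R * lnN = #|` fbox c d n|%:R * (lnN / p%:R).
    by rewrite mulrAC mulrA.
  rewrite [leLHS]mulrA [leLHS]mulrC; apply: ler_wpM2l => //; rewrite mulrC.
  have el : e' * (lnN / p%:R) = e by rewrite divfK// gt_eqF.
  have ee : 0 <= e' * e by rewrite mulr_ge0// ltW.
  by rewrite mulrDl mul1r mulrBr el; lra.
have upp : \forall n \near \oo,
    ent (law nu (pat (fbox c d n))) / #|` fbox c d n|%:R <= lnN / p%:R + e.
  near=> n; have n0 : (0 < n)%N by near: n; exists 1%N.
  rewrite ler_pdivrMr ?b0//.
  apply: le_trans (ent_pattern_le hd inu n mp0) _.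
  apply: (@le_trans _ _ ((ent (law nu (win (m * p))) / (m * p)%:R + e / 2) * #|` fbox c d n|%:R)).
    rewrite -[X in corners _ _ _ X]addn0.
    by near: n; exact: corners_density.
  by rewrite ler_wpM2r//; lra.
near=> n.
have h1 : lnN / p%:R - e <= ent (law nu (pat (fbox c d n))) / #|` fbox c d n|%:R.
  by near: n; exact: low.
have h2 : ent (law nu (pat (fbox c d n))) / #|` fbox c d n|%:R <= lnN / p%:R + e.
  by near: n; exact: upp.
rewrite ler_distl; apply/andP; split; lra.
Unshelve. all: by end_near.
Qed.

(** A generator: its join over a box is the partition by patterns on that box, so one partition
    already yields the lower bound on the entropy. *)
Definition letter_partition : set (set bor) :=
  [set [set x : bor | x 0 = a] | a in [set: F]].

Lemma letter_partitionP : finite_measurable_partition letter_partition.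
Proof.
split; first by apply: finite_image; exact: finite_finset.
- split.
  + apply/seteqP; split=> // x _; exists [set y : bor | y 0 = x 0] => //.
    by exists (x 0).
  + by move=> _ _ [a _ <-] [b _ <-] [x [/= <- <-]].
  + by move=> _ [a _ <-]; exists (fun=> a).
by move=> _ [a _ <-]; exact: (@discrete_rv_coordinate R c d F hF 0 a).
Qed.

Lemma partition_entropy_letter (rho : probability bor R) n :
  partition_entropy rho (join_shifts (@box c d n) letter_partition) =
  ent (law rho (pat (fbox c d n))).
Proof.
rewrite /partition_entropy (@partition_entropyE_law _ _ _ rho _ (pat (fbox c d n))) ?opprK//.
- move=> B [A [PA ->]]; right.
  have [a aE] : {a : G -> F & forall g, [set x : bor | x 0 = a g] = A g}.
    apply: (@choice G F (fun g a => [set x : bor | x 0 = a] = A g)) => g.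
    by have [a _ <-] := PA g; exists a.
  exists [ffun g => a (val g)]; apply/seteqP; split=> [x hx|x /= /ffunP hx g gn].
    apply/ffunP => g; rewrite !ffunE.
    have gn : @box c d n (val g) by have := valP g; rewrite in_fbox.
    by have := hx _ gn; rewrite -aE /= /shift addr0.
  have gn' : g \in fbox c d n by rewrite in_fbox.
  have := hx [` gn']%fset; rewrite !ffunE /= => xa.
  by rewrite -aE /= /shift addr0.
- move=> w [x0 _]; pose A g := if insub g is Some g' then [set x : bor | x 0 = w g'] else [set x : bor | x 0 = x0 0].
  exists A; split.
    by move=> g; rewrite /A; case: insubP => [g' _ _|_]; [exists (w g')|exists (x0 0)].
  apply/seteqP; split=> [x /= /ffunP hx g gn|x hx].
    have gn' : g \in fbox c d n by rewrite in_fbox.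
    rewrite /preimage /A /= insubT /= /shift addr0.
    by have := hx [` gn']%fset; rewrite !ffunE.
  apply/ffunP => g; rewrite ffunE.
  have gn : @box c d n (val g) by have := valP g; rewrite in_fbox.
  by have := hx _ gn; rewrite /preimage /A /= valK /= /shift addr0.
Qed.

Lemma entropy_mask_ge : ((lnN / p%:R)%:E <= entropy nu)%E.
Proof.
apply: (@le_trans _ _ (entropy_wrt nu letter_partition)%:E); last first.
  by apply: ereal_sup_ubound; exists letter_partition => //; exact: letter_partitionP.
rewrite lee_fin /entropy_wrt.
under eq_fun do rewrite partition_entropy_letter.
by rewrite (cvg_lim _ pattern_entropy_cvg).
Qed.

End MaskEntropy.

(** * Scales *)

(** The exponent starts at 1 so that every period exceeds 2, as the majority test on three sites
    requires. *)
Definition period (i : nat) : nat := (3 ^ i.+1)%N.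

(** In [24 = 3 * 8], the factor 3 makes the width a multiple of the periods in use at scale [k], and
    the factor 8 makes it outgrow the counting errors. *)
Definition width (k : nat) : nat := (24 ^ (k + 3))%N.

(** The exponent [width k] makes the energy Lipschitz, since scale [k] sees sites up to that radius;
    the extra [k] gives continuity in the signs for the Lipschitz norm. *)
Definition cost (R : realType) (k : nat) : R := 2 ^- (width k + k).

(** The value 0 means that no sign up to [k] is opposite to [a]; indices are raised by one so that
    an opposite sign at index 0 counts. *)
Definition last_switch (s : nat -> bool) (k : nat) (a : bool) : nat :=
  (\max_(j < k.+1 | s j != a) j.+1)%N.

Section Scales.

Lemma width_mono k l : (k < l)%N -> (width k < width l)%N.
Proof. by move=> kl; rewrite /width ltn_exp2l// ltn_add2r. Qed.

Lemma width_gt k : (k < width k)%N.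
Proof.
apply: (@leq_trans (24 ^ k)%N); first exact: ltn_expl.
by rewrite leq_exp2l// leq_addr.
Qed.

Lemma width_gt2 k : (2 < width k)%N.
Proof.
rewrite /width (@leq_trans (24 ^ 3)%N) ?leq_exp2l// ?leq_addl//.
Qed.

Lemma width_step k : (3 * (k + 2) <= width k.+1 - width k)%N.
Proof.
rewrite /width addSn expnS; have : (k + 3 < 24 ^ (k + 3))%N by exact: ltn_expl.
by move: (24 ^ (k + 3))%N => w; lia.
Qed.

Lemma period_dvd_width i k : (i <= k.+1)%N -> (period i %| width k)%N.
Proof.
move=> ik; rewrite /period /width (_ : 24 = 3 * 8)%N// expnMn.
by apply: dvdn_mulr; apply: dvdn_exp2l; lia.
Qed.

Lemma period_gt2 i : (2 < period i)%N.
Proof. by rewrite /period expnS; have := expn_gt0 3 i; lia. Qed.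

Lemma period_dvd i j : (i <= j)%N -> (period i %| period j)%N.
Proof. by move=> ij; exact: dvdn_exp2l. Qed.

Lemma last_switch_le s m n a : (forall j, (j <= n)%N -> s j != a -> (j < m)%N) ->
  (last_switch s n a <= m)%N.
Proof. by move=> h; apply/bigmax_leqP => j sj; apply: h; rewrite // -ltnS. Qed.

Lemma last_switch_mono s m n a : (forall j, (j <= n)%N -> s j != a -> (j <= m)%N) ->
  (last_switch s n a <= last_switch s m a)%N.
Proof.
move=> h; apply/bigmax_leqP => j sj.
have jm : (j < m.+1)%N by rewrite ltnS; apply: h; rewrite // -ltnS.
exact: (@leq_bigmax_cond _ _ (fun j : 'I_m.+1 => j.+1) (Ordinal jm)).
Qed.

Lemma last_switch_opp s m : last_switch s m (~~ s m) = m.+1.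
Proof.
apply/eqP; rewrite eqn_leq; apply/andP; split.
  by apply/bigmax_leqP => j _; rewrite ltnS -ltnS.
apply: (@leq_bigmax_cond _ _ (fun j : 'I_m.+1 => j.+1) ord_max) => /=.
by case: (s m).
Qed.

Lemma eq_last_switch s t k a : (forall j, (j <= k)%N -> s j = t j) ->
  last_switch s k a = last_switch t k a.
Proof. by move=> st; apply: eq_bigl => j; rewrite st// -ltnS. Qed.

Context (R : realType).
Local Notation cost := (cost R).

Lemma cost_gt0 k : 0 < cost k.
Proof. by rewrite invr_gt0 exprn_gt0. Qed.

Lemma cost_le k l : (k <= l)%N -> cost l <= cost k.
Proof.
rewrite leq_eqVlt => /predU1P[->//|kl].
rewrite lef_pV2 ?posrE ?exprn_gt0// ler_eXn2l ?ltr1n//.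
by have := width_mono kl; lia.
Qed.

Lemma cost_width k : cost k = 2 ^- width k * 2 ^- k.
Proof. by rewrite /cost exprD invfM. Qed.

Lemma cost_le_pow k : cost k <= 2 ^- k.
Proof.
rewrite cost_width ler_piMl ?invr_ge0 ?exprn_ge0//.
by rewrite invf_le1 ?exprn_gt0// exprn_ege1// ler1n.
Qed.

(** In units of [ln #|F|], the left side is the penalty of scale [k.+1] at inverse temperature
    [beta k]. *)
Lemma cost_ratio k : 2 * cost k.+1 / cost k <= 8 ^- (k + 2).
Proof.
rewrite /cost invrK.
have hw : (width k.+1 + k.+1 = (width k.+1 - width k).+1 + (width k + k))%N.
  by have := width_mono (ltnSn k); lia.
rewrite hw exprD invfM -mulrA -mulrA mulVf ?mulr1; last first.
  by rewrite expf_neq0// pnatr_eq0.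
rewrite exprS invfM mulrA divff ?mul1r ?pnatr_eq0//.
rewrite (_ : 8 = 2 ^+ 3); last by rewrite -natrX.
rewrite -exprM lef_pV2 ?posrE ?exprn_gt0// ler_eXn2l ?ltr1n//.
exact: width_step.
Qed.

(** In units of [ln #|F|], the numerator bounds the logarithms of the counting prefactors collected
    in [concentration]. *)
Lemma width_bound k : (4 * k%:R + 8) / (width k)%:R <= 8 ^- (k + 2) :> R.
Proof.
rewrite ler_pdivrMr ?ltr0n ?(ltn_trans _ (width_gt2 k))// [leRHS]mulrC ler_pdivlMr ?exprn_gt0//.
rewrite -natrM -!natrD -natrX -natrM ler_nat /width.
rewrite (_ : 24 = 3 * 8)%N// expnMn (_ : k + 3 = (k + 2).+1)%N; last by lia.
rewrite (expnS 8) mulnA leq_mul2r; apply/orP; right.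
by have : (k + 2 < 3 ^ (k + 2))%N by [exact: ltn_expl]; rewrite expnS; lia.
Qed.

End Scales.

(** * The potentials *)

Section Energy.
Context (R : realType) (c : coordinates) (d : nat) (hd : (1 <= d)%N).
Context (F : finType) (hF : (1 < #|F|)%N).
Local Notation G := (lattice c d).
Local Notation Sigma := (config R c d hF).
Local Notation bor := (borel R c d hF).
Local Notation win := (@window R c d hd F hF).
Local Notation cost := (cost R).
Variable z : bool -> F.

Definition bad (s : nat -> bool) (k : nat) (x : Sigma) : bool :=
  [forall a, win (width k) x \notin
     admissible (z a) (period (last_switch s k a)) (width k)].

(** Only the first violated scale is charged. As costs decrease, a violation at scale [k] still
    forces an energy of at least [cost k]. *)
Definition energy (s : nat -> bool) (x : Sigma) : R :=
  match pselect (exists k, bad s k x) with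
  | left h => cost (ex_minn h)
  | right _ => 0
  end.

Lemma energyP s x :
  (exists k, [/\ bad s k x, forall j, (j < k)%N -> ~~ bad s j x & energy s x = cost k]) \/
  (forall k, ~~ bad s k x) /\ energy s x = 0.
Proof.
rewrite /energy; case: pselect => [h|h]; [left|right].
  case: ex_minnP => k bk hk; exists k; split => // j jk.
  by apply: contraL jk => /hk; rewrite -leqNgt.
by split => // k; apply/negP => bk; apply: h; exists k.
Qed.

Lemma energy_ge0 s x : 0 <= energy s x.
Proof. by have [[k [_ _ ->]]|[_ ->]] := energyP s x; rewrite ?(ltW (cost_gt0 _ _)). Qed.

Lemma energy_le s x k : (forall j, (j < k)%N -> ~~ bad s j x) ->
  energy s x <= cost k.
Proof.
move=> h; have [[l [bl _ ->]]|[_ ->]] := energyP s x; last exact/ltW/cost_gt0.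
by apply: cost_le; rewrite leqNgt; apply: contraL bl => /h.
Qed.

Lemma energy_ge s x k : bad s k x -> cost k <= energy s x.
Proof.
move=> bk; have [[l [_ hl ->]]|[/(_ k) + _]] := energyP s x; last by rewrite bk.
by apply: cost_le; rewrite leqNgt; apply: contraL bk => /hl.
Qed.

(** Either there is a violation below [k], and the first one is the same on both sides, or both
    energies lie between 0 and [cost k]. *)
Lemma energy_near s t x y k :
  (forall j, (j < k)%N -> bad s j x = bad t j y) ->
  `|energy s x - energy t y| <= cost k.
Proof.
move=> st.
have [[j jk bj]|h] := pselect (exists2 j, (j < k)%N & bad s j x); last first.
  have hx j : (j < k)%N -> ~~ bad s j x by move=> jk; apply/negP => bj; apply: h; exists j.
  have hy j : (j < k)%N -> ~~ bad t j y by move=> jk; rewrite -st// hx.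
  have := energy_le hx; have := energy_le hy; have := energy_ge0 s x; have := energy_ge0 t y.
  by move=> *; rewrite ler_norml; apply/andP; split; lra.
suff -> : energy s x = energy t y by rewrite subrr normr0 ltW// cost_gt0.
have bj' : bad t j y by rewrite -st.
have [[l [bl hl ->]]|[/(_ j)]] := energyP s x; last by rewrite bj.
have [[l' [bl' hl' ->]]|[/(_ j)]] := energyP t y; last by rewrite bj'.
have lj : (l <= j)%N by rewrite leqNgt; apply: contraL bj => /hl.
have lj' : (l' <= j)%N by rewrite leqNgt; apply: contraL bj' => /hl'.
congr cost; apply/eqP; rewrite eqn_leq; apply/andP; split; rewrite leqNgt; apply/negP.
  by move=> ll; have := hl _ ll; rewrite (st _ (leq_ltn_trans lj' jk)) bl'.
by move=> ll; have := hl' _ ll; rewrite -(st _ (leq_ltn_trans lj jk)) bl.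
Qed.

Lemma bad_agree s k x y : agree (width k) x y -> bad s k x = bad s k y.
Proof.
move=> xy; rewrite /bad (_ : win (width k) x = win (width k) y)//.
by apply/ffunP => j; rewrite !ffunE; apply: xy; rewrite supnorm_axis ltn_ord.
Qed.

Lemma eq_bad s t k x : (forall j, (j <= k)%N -> s j = t j) -> bad s k x = bad t k x.
Proof. by move=> st; apply: eq_forallb => a; rewrite (eq_last_switch a st). Qed.

(** Take the first [k] for which the points differ within radius [width k]: smaller scales see
    identical windows. *)
Lemma separating_scale x y : x <> y -> exists k,
  (forall s j, (j < k)%N -> bad s j x = bad s j y) /\ 2 ^- width k <= mdist x y.
Proof.
move=> xy; have sep : exists k, ~~ `[< agree (width k) x y >].
  have [n /asboolP[g xyg gn]] := neq_config xy; exists n; apply/asboolPn => h.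
  by apply/xyg/h; rewrite gn; exact: width_gt.
exists (ex_minn sep); case: ex_minnP => k /asboolPn nk hk; split.
  move=> s j jk; apply: bad_agree; apply: contrapT => /asboolPn/hk.
  by rewrite leqNgt jk.
rewrite leNgt; apply/negP => /ltW h; apply: nk.
exact/dist_le.
Qed.

Lemma energy_lipschitz s x y : x <> y -> `|energy s x - energy s y| <= mdist x y.
Proof.
move=> /separating_scale[k [hk kxy]]; apply: le_trans (energy_near (hk s)) _.
apply: le_trans kxy; rewrite cost_width ler_piMr ?invr_ge0 ?exprn_ge0//.
by rewrite invf_le1 ?exprn_gt0// exprn_ege1// ler1n.
Qed.

(** The four terms are paired in two ways. If the separating scale [k] is at most [n], the two
    sequences are compared at each point, with error [cost n]; otherwise the two points are compared
    for each sequence, with error [cost k]. Either error is at most [2 ^- n * 2 ^- width k]. *)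
Lemma energy_sub_lipschitz s t n x y : (forall j, (j < n)%N -> s j = t j) -> x <> y ->
  `|(energy s x - energy t x) - (energy s y - energy t y)| <= 2 * 2 ^- n * mdist x y.
Proof.
move=> st /separating_scale[k [hk kxy]].
have bst j u : (j < n)%N -> bad s j u = bad t j u.
  by move=> jn; apply: eq_bad => i ij; apply: st; exact: leq_ltn_trans ij jn.
have pow_le i j : (i <= j)%N -> 2 ^- j <= 2 ^- i :> R.
  by move=> ij; rewrite lef_pV2 ?posrE ?exprn_gt0// ler_eXn2l// ltr1n.
have small e : e <= 2 ^- n * 2 ^- width k ->
    forall u v : R, `|u| <= e -> `|v| <= e -> `|u - v| <= 2 * 2 ^- n * mdist x y.
  move=> he u v ue ve; apply: le_trans (ler_normB _ _) _.
  apply: le_trans (lerD ue ve) _; rewrite -mulr2n -[leLHS]mulr_natl -mulrA.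
  by rewrite ler_wpM2l//; apply: le_trans he _; rewrite ler_wpM2l.
have [kn|nk] := leqP k n.
  apply: (@small (cost n)); last 2 first.
  - by apply: energy_near => j jn; exact: bst.
  - by apply: energy_near => j jn; exact: bst.
  rewrite cost_width mulrC ler_wpM2l// pow_le//.
  by move: kn; rewrite leq_eqVlt => /predU1P[->//|/width_mono/ltnW].
rewrite (_ : _ - _ = (energy s x - energy s y) - (energy t x - energy t y)); last by ring.
apply: (@small (cost k)); [|exact: energy_near (hk s)|exact: energy_near (hk t)].
by rewrite cost_width mulrC ler_wpM2r// pow_le// ltnW.
Qed.


Lemma lip_norm_le (f : Sigma -> R) (C D : R) :
  (forall x, `|f x| <= C) -> (forall x y, x <> y -> `|f x - f y| <= D * mdist x y) ->
  (lip_norm f <= (C + D)%:E)%E.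
Proof.
move=> fC fD; rewrite /lip_norm EFinD; apply: leeD.
  by apply: ge_ereal_sup => _ [x _ <-]; rewrite lee_fin.
apply: ge_ereal_sup => _ [[x y] /= xy <-]; rewrite lee_fin ler_pdivrMr ?fD//.
by rewrite mdist_gt0; exact/eqP.
Qed.

End Energy.

(** * Integrals of the potentials *)

Lemma near_prefix (s : sign_sequences) n :
  \forall t \near s, forall j, (j < n)%N -> (s : nat -> bool) j = (t : nat -> bool) j.
Proof.
elim: n => [|n ih]; first by apply: filterE => t j; rewrite ltn0.
have hn : \forall t \near s, (s : nat -> bool) n = (t : nat -> bool) n.
  have := @proj_continuous nat (fun=> bool) n s.
  move=> /(_ [set b | (s : nat -> bool) n = b]); apply.
  rewrite (_ : [set b | _] = [set (s : nat -> bool) n]); first exact: discrete_set1.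
  by apply/seteqP; split=> b /= ->.
apply: filterS2 ih hn => t ih hn j; rewrite ltnS leq_eqVlt => /predU1P[->//|].
exact: ih.
Qed.

Section Integrals.
Context (R : realType) (c : coordinates) (d : nat) (hd : (1 <= d)%N).
Context (F : finType) (hF : (1 < #|F|)%N).
Local Notation G := (lattice c d).
Local Notation Sigma := (config R c d hF).
Local Notation bor := (borel R c d hF).
Local Notation win := (@window R c d hd F hF).
Local Notation cost := (cost R).
Variable z : bool -> F.
Variable s : nat -> bool.
Local Notation E := (@energy R c d hd F hF z s).
Local Notation bad := (@bad R c d hd F hF z s).

(** The energy is lower semicontinuous: a violation at scale [k] persists near the point and keeps
    the energy at least [cost k], so the sets where it exceeds a given value are open. *)
Lemma measurable_energy : measurable_fun [set: bor] (E : bor -> R).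
Proof.
move=> mT; apply: (measurability _ (RGenOInfty.measurableE R)) => // _ [_ [r ->] <-].
rewrite setTI; apply: sub_sigma_algebra.
rewrite openE => x /=; rewrite in_itv /= andbT => rx.
apply/nbhs_agreeP.
have [[k [bk hk Ek]]|[_ Ex]] := energyP hd z s x; last first.
  exists 0%N => y _ /=; rewrite in_itv /= andbT; apply: lt_le_trans (energy_ge0 _ _ _ _).
  by rewrite -Ex.
exists (width k) => y xy /=; rewrite in_itv /= andbT.
have [[l [bl hl ->]]|[/(_ k)]] := energyP hd z s y; last first.
  by rewrite -(bad_agree hd z s xy) bk.
apply: lt_le_trans rx _; rewrite Ek; apply: cost_le.
by rewrite leqNgt; apply/negP => kl; have := hl _ kl; rewrite -(bad_agree hd z s xy) bk.
Qed.

Lemma discrete_bad k : discrete_rv (bad k : bor -> bool).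
Proof. by apply: (@discrete_rv_local R c d F hF _ _ (width k)) => x y; exact: bad_agree. Qed.

Lemma measurable_bad k : measurable [set x : bor | bad k x].
Proof. exact: (discrete_rv_preimage [set b | is_true b] (@discrete_bad k)). Qed.

Variable rho : probability bor R.
Variable b : R.
Hypothesis b0 : 0 <= b.

Lemma energy_term_ge0 (x : bor) : (0 <= (b * E x)%:E)%E.
Proof. by rewrite lee_fin mulr_ge0// energy_ge0. Qed.

Lemma measurable_energy_term : measurable_fun [set: bor] (EFin \o (fun x : bor => b * E x : R) : bor -> \bar R).
Proof.
apply/measurable_EFinP; apply: measurable_funM; first exact: measurable_cst.
exact: measurable_energy.
Qed.

Lemma integral_energyN :
  (\int[rho]_x (b * - E x)%:E = - \int[rho]_x (b * E x)%:E)%E.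
Proof.
rewrite -integral_ge0N; last by move=> x _; exact: energy_term_ge0.
by apply: eq_integral => x _; rewrite mulrN EFinN.
Qed.

Lemma integral_energy_ge k :
  ((b * cost k * fine (rho [set x : bor | bad k x]))%:E <= \int[rho]_x (b * E x)%:E)%E.
Proof.
have mB := measurable_bad k.
have bc : 0 <= b * cost k by rewrite mulr_ge0// ltW// cost_gt0.
have m1 : measurable_fun [set: bor] (EFin \o (fun x : bor => \1_[set x : bor | bad k x] x : R)).
  by apply/measurable_EFinP; exact: measurable_indic.
have i0 (x : bor) : (0 <= (\1_[set x : bor | bad k x] x)%:E :> \bar R)%E.
  by rewrite lee_fin.
have -> : ((b * cost k * fine (rho [set x : bor | bad k x]))%:E =
    \int[rho]_x ((b * cost k)%:E * (\1_[set x : bor | bad k x] x)%:E))%E.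
  rewrite ge0_integralZl// integral_indic// setIT EFinM fineK//.
  exact: fin_num_measure.
apply: ge0_le_integral => //.
- by move=> x _; rewrite mule_ge0.
- exact: measurable_funeM.
- exact: measurable_energy_term.
move=> x _; rewrite -EFinM lee_fin -mulrA ler_wpM2l// indicE.
have [xB|xB] := boolP (bad k x).
  rewrite mem_set// mulr1; exact: energy_ge.
by rewrite memNset ?mulr0 ?energy_ge0//; exact/negP.
Qed.

Lemma integral_energy_le k : (forall j, (j <= k)%N -> rho [set x : bor | bad j x] = 0%E) ->
  (\int[rho]_x (b * E x)%:E <= (b * cost k.+1)%:E)%E.
Proof.
move=> h.
have bc : 0 <= b * cost k.+1 by rewrite mulr_ge0// ltW// cost_gt0.
have -> : ((b * cost k.+1)%:E = \int[rho]_x (cst (b * cost k.+1)%:E x))%E.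
  by rewrite integral_cst// -[LHS]mule1; congr (_ * _)%E; exact/esym/probability_setT.
apply: ae_ge0_le_integral => //.
- by move=> x _; exact: energy_term_ge0.
- exact: measurable_energy_term.
pose A : set bor := \big[setU/set0]_(j < k.+1) [set x : bor | bad j x].
exists A; split.
- by apply: bigsetU_measurable => j _; exact: measurable_bad.
- apply/eqP; rewrite eq_le measure_ge0 andbT.
  apply: le_trans (Boole_inequality rho (A := fun j => [set x : bor | bad j x]) _) _.
    by move=> j _; exact: measurable_bad.
  by rewrite big1// => j _; apply: h; rewrite -ltnS.
move=> x /= /not_implyP[_ /negP]; rewrite lee_fin -ltNge => hx.
have [[j jk bj]|nb] := pselect (exists2 j, (j < k.+1)%N & bad j x).
  by rewrite /A -(bigcup_mkord k.+1 (fun j => [set x : bor | bad j x])); exists j.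
have : E x <= cost k.+1.
  by apply: energy_le => j jk; apply/negP => bj; apply: nb; exists j.
by move=> /(ler_wpM2l b0); rewrite leNgt hx.
Qed.

End Integrals.

(** * Concentration of equilibrium states *)

Section Concentration.
Context (R : realType) (c : coordinates) (d : nat) (hd : (1 <= d)%N).
Context (F : finType) (hF : (1 < #|F|)%N).
Local Notation G := (lattice c d).
Local Notation Sigma := (config R c d hF).
Local Notation bor := (borel R c d hF).
Local Notation win := (@window R c d hd F hF).
Local Notation cost := (cost R).
Local Notation N := #|F|.
Local Notation lnN := (ln (#|F|%:R : R)).
Variable z : bool -> F.
Hypothesis zNE : z true != z false.

Definition majority (a : F) (x : Sigma) : bool :=
  let e i := x (axis c hd i) == a in
  [|| e 0%N && e 1%N, e 0%N && e 2%N | e 1%N && e 2%N].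

(* Since the period exceeds 2, at most one of three consecutive sites is free. *)
Lemma admissible_majority a p M x : (2 < p)%N -> (2 < M)%N ->
  win M x \in admissible a p M -> majority a x.
Proof.
move=> p2 M2; rewrite inE => /existsP[q /forallP h].
have h' i (i2 : (i <= 2)%N) : (i == q :> nat) || (x (axis c hd i) == a).
  have := h (Ordinal (leq_ltn_trans i2 M2)).
  by rewrite ffunE /= modn_small// (leq_ltn_trans i2).
have := (h' 0%N isT, h' 1%N isT, h' 2%N isT); rewrite /majority => -[[]].
move: (nat_of_ord q) => {h h'} n.
move: (_ == a) (_ == a) (_ == a) => e0 e1 e2.
by case: n => [|[|[|n]]] /=; case: e0; case: e1; case: e2.
Qed.

Lemma majority_unique a a' x : majority a x -> majority a' x -> a = a'.
Proof.
by rewrite /majority => /or3P[]/andP[/eqP e1 /eqP e2] /or3P[]/andP[/eqP e3 /eqP e4];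
  congruence.
Qed.

Lemma window_surjective M w : exists x : Sigma, win M x = w.
Proof.
exists (fun g => if [pick k : 'I_M | axis c hd k == g] is Some k then w k else z true).
apply/ffunP => k; rewrite ffunE; case: pickP => [l /eqP/axis_inj/val_inj -> //|/(_ k)].
by rewrite eqxx.
Qed.

Lemma admissible_disjoint a p p' M w : (2 < p)%N -> (2 < p')%N -> (2 < M)%N ->
  w \in admissible (z a) p M -> w \notin admissible (z (~~ a)) p' M.
Proof.
move=> p2 p2' M2 wa; apply/negP => wa'; have [x xw] := window_surjective w.
rewrite -xw in wa wa'.
have := majority_unique (admissible_majority p2 M2 wa) (admissible_majority p2' M2 wa').
by move/eqP; case: a {wa wa'} => /=; rewrite ?[z false == _]eq_sym (negbTE zNE).
Qed.

(** The second set is a complement, not [majority (z false)], because the two must be complementary;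
    configurations with neither majority fall into it. *)
Definition well (a : bool) : set Sigma :=
  if a then [set x | majority (z true) x] else ~` [set x | majority (z true) x].

Lemma majority_well a x : majority (z a) x -> well a x.
Proof.
case: a => //= mf mt; have := majority_unique mt mf.
by move/eqP; rewrite (negbTE zNE).
Qed.

Lemma local_well a : local_set 3 (well a).
Proof.
suff h : local_set 3 [set x | majority (z true) x].
  by case: a => //=; exact: local_setC.
move=> x y xy; rewrite /= /majority.
by rewrite !xy ?supnorm_axis.
Qed.

(** A residue class modulo [p] lies in a residue class modulo [p'], so the shorter period frees more
    positions. *)
Lemma admissible_dvd a p p' M : (0 < p')%N -> (p' %| p)%N ->
  admissible a p M \subset (admissible a p' M : {set {ffun 'I_M -> F}}).
Proof.
move=> p0 pp; apply/fintype.subsetP => w; rewrite !inE => /existsP[q /forallP h].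
apply/existsP; exists (Ordinal (ltn_pmod q p0)); apply/forallP => k.
have := h k; case: eqP => [<- _|_ /= ->]; last by rewrite orbT.
by rewrite /= modn_dvdm// eqxx.
Qed.

(** * One block of constant signs *)

Section Stage.
Variables (s : nat -> bool) (m mhat : nat).
Hypothesis constant_sign : forall j, (m <= j <= mhat)%N -> s j = s m.
Let a := s m.
Let p := period (last_switch s m a).
Let M := width m.
Let A := admissible (z a) p M.
Let B := admissible (z (~~ a)) (period m.+1) M.

Lemma last_switch_stage : (last_switch s m a <= m)%N.
Proof.
apply: last_switch_le => j jm sj; rewrite ltn_neqAle jm andbT.
by apply: contraNneq sj => ->.
Qed.

(** No sign between [m] and [mhat] is opposite to [a], so the favoured period does not grow there;
    before [m] it can only be shorter. *)
Lemma last_switch_stable k : (k <= mhat)%N -> (last_switch s k a <= last_switch s m a)%N.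
Proof.
move=> km; apply: last_switch_mono => j jk; apply: contraNT; rewrite -ltnNge => mj.
by rewrite constant_sign// ltnW//= (leq_trans jk).
Qed.

Lemma bad_stage x : @bad R c d hd F hF z s m x = (win M x \notin A) && (win M x \notin B).
Proof.
rewrite /bad; have e := last_switch_opp s m.
apply/forallP/andP => [h|[hA hB] a'].
  by split; [exact: (h a)|have := h (~~ a); rewrite e].
have [->|] := eqVneq a' a; first exact: hA.
move=> aa; have -> : a' = ~~ a by move: aa; case: (a'); case: (a).
by rewrite e.
Qed.

(** The period required of the favoured side at scale [k] divides [p], so every pattern of the
    masked measure is admissible at that scale. *)
Lemma mask_bad0 k : (k <= mhat)%N ->
  @mask_prob R c d hd F hF (z a) p [set x : bor | @bad R c d hd F hF z s k x] = 0%E.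
Proof.
move=> km; have p0 : (0 < p)%N by rewrite (ltn_trans _ (period_gt2 _)).
set P := mask_prob _ _ _ _ _ _.
pose K := admissible (z a) (period (last_switch s k a)) (width k).
have mW := @discrete_rv_window R c d hd F hF (width k).
have mK : measurable (win (width k) @^-1` [set w | w \in K]).
  exact: discrete_rv_preimage.
have : P (win (width k) @^-1` [set w | w \in K]) = 1%E.
  rewrite -[LHS]fineK ?fin_num_measure// mask_prob_admissible//.
  apply: admissible_dvd; first by rewrite (ltn_trans _ (period_gt2 _)).
  by apply: period_dvd; exact: last_switch_stable.
move=> PK; apply/eqP; rewrite eq_le measure_ge0 andbT.
apply: (@le_trans _ _ (P (~` (win (width k) @^-1` [set w | w \in K])))).
  apply: le_measure; rewrite ?inE; [exact: measurable_bad|exact: measurableC|].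
  by move=> x /= /forallP/(_ a)/negP.
by rewrite probability_setC// PK subee.
Qed.

Variable rho : probability bor R.
Local Notation alpha := (fine (rho (win M @^-1` [set w | w \in B]))).
Local Notation gamma := (fine (rho (win M @^-1` [set w | w \in A]))).

Lemma disjoint_stage w : w \in A -> w \notin B.
Proof. by apply: admissible_disjoint; rewrite ?period_gt2 ?width_gt2. Qed.

Lemma bad_stage_mass :
  fine (rho [set x : bor | @bad R c d hd F hF z s m x]) = 1 - gamma - alpha.
Proof.
have mW := @discrete_rv_window R c d hd F hF M.
pose C := [set w | (w \notin A) && (w \notin B)]%SET.
rewrite (_ : [set x | _] = win M @^-1` [set w | w \in C]); last first.
  by apply/seteqP; split=> x /=; rewrite bad_stage !inE.
rewrite !probability_set_fin//.
have := (law_pmf rho mW).2; rewrite (bigID (fun w => w \in A)) /=.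
rewrite [X in _ + X](bigID (fun w => w \in B)) /=.
have -> : \sum_(w | (w \notin A) && (w \in B)) law rho (win M) w =
    \sum_(w in B) law rho (win M) w.
  apply: eq_bigl => w; apply/andP/idP => [[]//|wB]; split=> //.
  by apply: contraTN wB => /disjoint_stage.
have -> : \sum_(w | (w \notin A) && (w \notin B)) law rho (win M) w =
    \sum_(w in C) law rho (win M) w.
  by apply: eq_bigl => w; rewrite [RHS]inE.
by move=> <-; ring.
Qed.

Let bad_mass := fine (rho [set x : bor | @bad R c d hd F hF z s m x]).

Lemma ent_window_stage : ent (law rho (win M)) <=
  ln 3 + gamma * ln (p * N ^ (M %/ p))%:R
  + alpha * ln (period m.+1 * N ^ (M %/ period m.+1))%:R + bad_mass * (M%:R * lnN).
Proof.
have mW := @discrete_rv_window R c d hd F hF M.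
have p0 i : (0 < period i)%N by rewrite (ltn_trans _ (period_gt2 _)).
have N0 k : (0 < N ^ k)%N by rewrite expn_gt0 (ltnW hF).
have dp : (p %| M)%N.
  by apply: period_dvd_width; rewrite (leq_trans last_switch_stage)// leqnSn.
have dp' : (period m.+1 %| M)%N by exact: period_dvd_width.
have cA : (#|A| <= p * N ^ (M %/ p))%N.
  by have := @card_admissible F (z a) p (M %/ p) (p0 _); rewrite divnK.
have cB : (#|B| <= period m.+1 * N ^ (M %/ period m.+1))%N.
  by have := @card_admissible F (z (~~ a)) (period m.+1) (M %/ period m.+1) (p0 _); rewrite divnK.
have := @ent_two_classes R _ (law rho (win M)) A B
  (p * N ^ (M %/ p))%:R (period m.+1 * N ^ (M %/ period m.+1))%:R gamma alpha
  (law_pmf rho mW) disjoint_stage.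
rewrite !ler_nat !ltr0n !muln_gt0 !p0 !N0 => /(_ cA cB isT isT).
move=> /(_ (probability_set_fin rho A mW) (probability_set_fin rho B mW)).
by rewrite card_ffun card_ord natrX lnXn ?ltr0n ?(ltnW hF)// mulr_natl -bad_stage_mass.
Qed.

(** The left side bounds from below the free energy of the masked measure, which is charged only
    beyond [mhat]; the right side bounds that of [rho] from above, keeping only its violations at
    scale [m]. *)
Lemma equilibrium_inequality (b : R) : 0 <= b ->
  equilibrium_state (fun x => b * - @energy R c d hd F hF z s x) rho ->
  lnN / p%:R - b * cost mhat.+1 <=
    ent (law rho (win M)) / M%:R - b * cost m * bad_mass.
Proof.
move=> b0 [rho_inv rho_eq].
have p0 : (0 < p)%N by rewrite (ltn_trans _ (period_gt2 _)).
have M0 : (0 < M)%N by rewrite (ltn_trans _ (width_gt2 _)).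
pose nu := @mask_prob R c d hd F hF (z a) p.
have nu_inv : shift_invariant nu by exact: shift_invariant_mask_prob.
pose phi : Sigma -> R := fun x => b * - @energy R c d hd F hF z s x.
have : (free_energy phi nu <= free_energy phi rho)%E.
  by rewrite rho_eq; apply: ereal_sup_ubound; exists nu.
rewrite /free_energy /phi !integral_energyN// => h.
rewrite -lee_fin !EFinB.
apply: (@le_trans _ _ (entropy nu - \int[nu]_x (b * @energy R c d hd F hF z s x)%:E)%E).
  apply: leeD; first exact: entropy_mask_ge.
  by rewrite leeN2; apply: integral_energy_le => // j; exact: mask_bad0.
apply: (le_trans h); apply: leeD; first exact: entropy_le_window.
by rewrite leeN2; exact: integral_energy_ge.
Qed.

End Stage.
End Concentration.

(** * Quantitative concentration and regularity of the potentials *)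

Section Potentials.
Context (R : realType) (c : coordinates) (d : nat) (hd : (1 <= d)%N).
Context (F : finType) (hF : (1 < #|F|)%N).
Local Notation Sigma := (config R c d hF).
Local Notation bor := (borel R c d hF).
Local Notation win := (@window R c d hd F hF).
Local Notation cost := (cost R).
Local Notation N := #|F|.
Local Notation lnN := (ln (#|F|%:R : R)).
Local Notation E z s := (@energy R c d hd F hF z s).

Lemma ln3_le : ln (3 : R) <= 2 * lnN.
Proof.
have : ln (3 : R) <= ln (2 ^+ 2).
  by rewrite ler_ln ?posrE ?exprn_gt0// -natrX ler_nat.
move=> /le_trans; apply; rewrite lnXn// -[ln 2 *+ 2]mulr_natl ler_wpM2l//.
by rewrite ler_ln ?posrE ?ltr0n ?ler_nat// ltnW.
Qed.

Lemma ln_period i : ln (period i)%:R = (i.+1)%:R * ln (3 : R).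
Proof. by rewrite /period natrX lnXn// -[ln 3 *+ _]mulr_natl. Qed.

Section Stage.
Variables (z : bool -> F) (s : nat -> bool) (m mhat : nat).
Hypothesis zNE : z true != z false.
Hypothesis constant_sign : forall j, (m <= j <= mhat)%N -> s j = s m.

Lemma concentration (rho : probability bor R) (b : R) :
  2 * lnN <= b * cost m -> b * cost mhat.+1 <= lnN * 8 ^- (m + 2) ->
  equilibrium_state (fun x => b * - E z s x) rho ->
  ((1 - 2 ^- m.+1)%:E <= rho (well hd z (s m)))%E.
Proof.
move=> bm bmhat eq_rho.
have L0 : 0 < lnN by exact: lnN_gt0.
have b0 : 0 <= b.
  rewrite -(pmulr_lge0 _ (cost_gt0 R m)); apply: le_trans bm.
  by rewrite mulr_ge0// ltW.
have := equilibrium_inequality constant_sign b0 eq_rho.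
have := @ent_window_stage R c d hd F hF z zNE s m rho.
have := @bad_stage_mass R c d hd F hF z zNE s m rho.
have mW := @discrete_rv_window R c d hd F hF (width m).
set dl := fine (rho [set x | _]).
set p := period (last_switch s m (s m)).
set A := admissible (z (s m)) p (width m).
set B := admissible _ (period m.+1) (width m).
set ga := fine (rho (win (width m) @^-1` [set w | w \in A])).
set al := fine (rho (win (width m) @^-1` [set w | w \in B])).
set H := ent _.
move=> dlE HE main.
have al0 : 0 <= al by rewrite /al fine_ge0.
have ga0 : 0 <= ga by rewrite /ga fine_ge0.
have dl0 : 0 <= dl by rewrite /dl fine_ge0.
have M0 : 0 < (width m)%:R :> R by rewrite ltr0n (ltn_trans _ (width_gt2 _)).
have pm : (last_switch s m (s m) <= m)%N by exact: last_switch_stage.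
have p0 i : 0 < (period i)%:R :> R by rewrite ltr0n (ltn_trans _ (period_gt2 _)).
have N0 : 0 < N%:R :> R by rewrite ltr0n ltnW.
(* The part of [ent_window_stage] that does not grow with the width, with [ga] and [al] bounded by
   1. *)
pose Q : R := ln 3 + ln p%:R + ln (period m.+1)%:R.
have ln30 : 0 <= ln (3 : R) by rewrite ln_ge0// ler1n.
have QM : Q / (width m)%:R <= lnN * 8 ^- (m + 2).
  have hQ : Q <= lnN * (4 * m%:R + 8).
    rewrite /Q !ln_period.
    have h1 : (last_switch s m (s m)).+1%:R * ln (3 : R) <= m.+1%:R * ln 3.
      by rewrite ler_wpM2r// ler_nat.
    have h2 := ln3_le; have m0 : 0 <= m%:R :> R by [].
    have : (2 * m%:R + 4) * ln (3 : R) <= (2 * m%:R + 4) * (2 * lnN).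
      by rewrite ler_wpM2l// addr_ge0// mulr_ge0.
    have -> : m.+2%:R = m%:R + 2 :> R by rewrite -natrD addn2.
    have : m.+1%:R * ln (3 : R) = (m%:R + 1) * ln 3 by rewrite -natr1.
    by lra.
  apply: (@le_trans _ _ (lnN * (4 * m%:R + 8) / (width m)%:R)).
    by rewrite ler_wpM2r// invr_ge0 ltW.
  by rewrite -mulrA ler_wpM2l ?(ltW L0)//; exact: width_bound.
have lnA i : (i <= m.+1)%N -> ln (period i * N ^ (width m %/ period i))%:R =
    ln (period i)%:R + (width m)%:R / (period i)%:R * lnN :> R.
  move=> im; rewrite natrM natrX lnM ?posrE ?exprn_gt0//.
  rewrite (lnXn _ N0) -[lnN *+ _]mulr_natl; congr (_ + _ * _).
  rewrite -[in RHS](divnK (period_dvd_width im)) natrM mulfK//.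
  by rewrite gt_eqF.
move: HE; rewrite /p !lnA ?(leq_trans pm)// -/p => HE.
have lp0 i : 0 <= ln (period i)%:R :> R.
  by rewrite ln_ge0// ler1n (ltn_trans _ (period_gt2 _)).
set u : R := p%:R^-1; set v : R := (period m.+1)%:R^-1.
have v0 : 0 < v by rewrite invr_gt0.
have HM : H / (width m)%:R <= Q / (width m)%:R + lnN * (ga * u + al * v + dl).
  rewrite ler_pdivrMr// mulrDl divfK ?gt_eqF//; apply: le_trans HE _.
  have ga1 : ga <= 1 by lra.
  have al1 : al <= 1 by lra.
  have h1 : ga * ln p%:R <= ln p%:R by rewrite ler_piMl// lp0.
  have h2 : al * ln (period m.+1)%:R <= ln (period m.+1)%:R by rewrite ler_piMl// lp0.
  rewrite /Q -/u -/v; lra.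
(* The opposite side has period exponent [m + 2] exactly, the favoured side at most [m + 1]. *)
have uv : 3 * v <= u.
  rewrite /u /v ler_pdivrMr// [leRHS]mulrC ler_pdivlMr ?(p0 (last_switch s m (s m)))// -natrM ler_nat.
  by rewrite /p /period [X in (_ <= X)%N]expnS leq_mul2l /= leq_exp2l.
(* Write [eps] for the right side. Substituting [ga = 1 - al - dl] in [main] and dividing by
   [ln #|F|] gives [(al + dl) * u <= 2 * eps + al * v - dl]; with [3 * v <= u] this leaves
   [2 * v * (al + dl) <= 2 * eps]. *)
have key : (al + dl) * v <= 8 ^- (m + 2).
  have dlb : dl * (2 * lnN) <= dl * (b * cost m) by rewrite ler_wpM2l.
  have uvL : (al + dl) * lnN * (3 * v) <= (al + dl) * lnN * u.
    by apply: ler_wpM2l => //; apply: mulr_ge0; [exact: addr_ge0|exact: ltW].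
  have dlv : 0 <= dl * lnN * v by rewrite !mulr_ge0// ltW.
  have gaE : ga = 1 - al - dl by lra.
  rewrite -(ler_pM2l L0); rewrite gaE in HM; rewrite -/u in main.
  have dlL : 0 <= dl * lnN by rewrite mulr_ge0// ltW.
  nra.
(* Since [v = 3 ^- (m + 2)], this reduces to [2 ^ (m + 1) * 3 ^ (m + 2) <= 8 ^ (m + 2)]. *)
have fin : al + dl <= 2 ^- m.+1.
  rewrite -(ler_pM2r v0); apply: (le_trans key).
  have -> : v = (3 ^+ (m + 2))^-1 by rewrite /v /period natrX addn2.
  rewrite -invfM lef_pV2 ?posrE ?mulr_gt0 ?exprn_gt0//.
  rewrite -!natrX -natrM ler_nat.
  apply: (@leq_trans (2 ^ (m + 2) * 4 ^ (m + 2))%N); last by rewrite -expnMn.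
  by apply: leq_mul; [rewrite leq_exp2l// addn2|rewrite leq_exp2r// addn2].
have mA : measurable (win (width m) @^-1` [set w | w \in A] : set bor).
  exact: discrete_rv_preimage.
have mU : measurable (well hd z (s m) : set bor).
  exact: measurable_local (@local_well R c d hd F hF z (s m)).
apply: (@le_trans _ _ (rho (win (width m) @^-1` [set w | w \in A]))).
  rewrite -[leRHS]fineK ?fin_num_measure// lee_fin -/ga; lra.
apply: le_measure; rewrite ?inE// => x /= xA.
by apply: majority_well => //; apply: admissible_majority xA; rewrite ?period_gt2 ?width_gt2.
Qed.

End Stage.

Lemma potential_lipschitz z s : lipschitz_continuous (fun x : Sigma => - E z s x).
Proof.
apply: (@le_lt_trans _ _ (1 + 1)%:E); last by rewrite ltry.
apply: lip_norm_le => [x|x y xy].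
  rewrite normrN ger0_norm ?energy_ge0//.
  apply: le_trans (energy_le (k := 0%N) _) _ => //.
  by apply: le_trans (cost_le_pow R 0) _; rewrite expr0 invr1.
by rewrite mul1r -opprD normrN; exact: energy_lipschitz.
Qed.

Lemma potential_continuous z :
  continuous_in_lip_norm (fun (s : sign_sequences) (x : Sigma) => - E z s x).
Proof.
(* One third for the supremum part of the norm, two for the Lipschitz part bounded by
   [energy_sub_lipschitz]. *)
move=> s e e0; have e3 : 0 < e / 3 by rewrite divr_gt0.
have [n] := ltr_add_invr e3; rewrite add0r => hn.
have {}hn : 2 ^- n.+1 < e / 3.
  apply: le_lt_trans hn.
  by rewrite lef_pV2 ?posrE ?exprn_gt0// -natrX ler_nat ltnW// ltn_expl.
apply: filterS (near_prefix s n.+1) => t st.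
apply: (@le_lt_trans _ _ (2 ^- n.+1 + 2 * 2 ^- n.+1)%:E); last by rewrite lte_fin; lra.
apply: lip_norm_le => [x|x y xy].
  rewrite opprK addrC; apply: le_trans (cost_le_pow R n.+1).
  apply: energy_near => j jn; apply: eq_bad => i ij; apply: st; exact: leq_ltn_trans ij jn.
rewrite !opprK ![- _ + _]addrC; exact: energy_sub_lipschitz.
Qed.

End Potentials.

Theorem lemmaB (R : realType) (d : nat) (hd : (1 <= d)%N) (c : coordinates)
    (F : finType) (hF : (2 <= #|F|)%N) :
  exists (phi : sign_sequences -> config R c d hF -> R)
         (U : bool -> set (config R c d hF))
         (beta : nat -> R),
    [/\ (forall s, lipschitz_continuous (phi s)) /\ continuous_in_lip_norm phi,
        [/\ open (U true), open (U false) & U false = ~` U true],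
        [/\ forall m, 0 < beta m,
            forall m n, (m < n)%N -> beta m < beta n
          & beta @ \oo --> +oo] &
        forall (s : sign_sequences) (m mhat : nat),
          (m <= mhat)%N ->
          (forall j, (m <= j <= mhat)%N -> s j = s m) ->
          forall b : R, beta m <= b <= beta mhat ->
          forall rho : probability (borel R c d hF) R,
            equilibrium_state (fun x => b * phi s x) rho ->
            ((1 - 2 ^- m.+1)%:E <= rho (U (s m)))%E].
Proof.
have /card_gt1P[a0 [a1 [_ _ a01]]] := hF.
pose z (e : bool) := if e then a0 else a1.
have zNE : z true != z false by exact: a01.
have L0 : 0 < ln (#|F|%:R : R) by exact: lnN_gt0.
pose beta m : R := 2 * ln (#|F|%:R : R) / cost R m.
have betaE m : beta m = 2 * ln (#|F|%:R : R) * 2 ^+ (width m + m).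
  by rewrite /beta /cost invrK.
exists (fun s x => - @energy R c d hd F hF z s x), (@well R c d hd F hF z), beta.
split.
- split; [exact: potential_lipschitz|exact: potential_continuous].
- split=> //; exact: (local_set_open (@local_well _ _ _ _ _ _ z _)).
- split.
  + by move=> m; rewrite divr_gt0 ?mulr_gt0// cost_gt0.
  + move=> m n mn; rewrite !betaE ltr_pM2l ?mulr_gt0// ltr_eXn2l ?ltr1n//.
    by have := width_mono mn; lia.
  + apply/cvgryPge => C.
    exists (Num.trunc (C / (2 * ln (#|F|%:R : R)))).+1 => // n /= nC.
    rewrite betaE mulrC -ler_pdivrMr ?mulr_gt0//.
    apply: (@le_trans _ _ n%:R); last first.
      by rewrite -natrX ler_nat ltnW// (leq_trans (ltn_expl n (ltnSn 1)))// leq_exp2l// leq_addl.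
    by apply: ltW; apply: lt_le_trans (truncnS_gt _) _; rewrite ler_nat.
move=> s m mhat mmhat sign b /andP[bm bmhat] rho.
apply: (concentration zNE (mhat := mhat)) => //.
- by rewrite -ler_pdivrMr ?cost_gt0.
(* The penalty beyond [mhat] is largest at [beta mhat], where [cost_ratio] gives [8 ^- (mhat + 2)],
   at most [8 ^- (m + 2)]. *)
apply: (@le_trans _ _ (beta mhat * cost R mhat.+1)).
  by rewrite ler_wpM2r// ltW// cost_gt0.
have -> : beta mhat * cost R mhat.+1 =
    ln (#|F|%:R : R) * (2 * cost R mhat.+1 / cost R mhat) by rewrite /beta; ring.
rewrite ler_pM2l//; apply: le_trans (cost_ratio R mhat) _.
by rewrite lef_pV2 ?posrE ?exprn_gt0// ler_eXn2l ?ltr1n// leq_add2r.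
Qed.
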